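(* Let $K_4^-$ be the $3$-graph with edges $\{abc,abd,acd\}$ on vertex set $\{a,b,c,d\}$, let $F^\star$ be the $3$-graph with edges $\{123,124,345,156,257\}$ on vertex set $\{1,\dots,7\}$, and let $F=K_4^-\times F^\star$ be their categorical product. Then $\pi(F)=\frac29$ and $\xi(F)=\infty$.
   Context: A $3$-graph $H$ is a set of $3$-element subsets (edges) of a finite vertex set $V(H)$; $|H|$ denotes its number of edges. For a family $\mathcal F$ of $3$-graphs, $\mathrm{ex}(n,\mathcal F)$ is the maximum number of edges in an $n$-vertex $3$-graph containing no member of $\mathcal F$ as a subgraph ($\mathcal F$-free), and $\pi(\mathcal F)=\lim_{n\to\infty}\mathrm{ex}(n,\mathcal F)/\binom n3$; for a single graph write $\pi(F)$, $\mathrm{ex}(n,F)$. The categorical product $G\times H$ of $3$-graphs has vertex set $V(G)\times V(H)$, and a triple $\{(x_1,y_1),(x_2,y_2),(x_3,y_3)\}$ is an edge iff $\{x_1,x_2,x_3\}\in G$ and $\{y_1,y_2,y_3\}\in H$ (so $F$ has $28$ vertices and $90$ edges). Stability number: $\mathcal F$ is $t$-stable if for every $m\in\mathbb N$ there exist $3$-graphs $G_1(m),\dots,G_t(m)$ on $m$ vertices such that for every $\delta>0$ there exist $\epsilon>0$ and $N_0$ such that whenever $n\ge N_0$ and $H$ is an $n$-vertex $\mathcal F$-free $3$-graph with $|H|>(1-\epsilon)\mathrm{ex}(n,\mathcal F)$, after relabelling vertices $H$ can be transformed into some $G_i(n)$ by adding and deleting at most $\delta n^3$ edges. The stability number $\xi(\mathcal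 F)$ is the least such $t$, and $\xi(\mathcal F)=\infty$ if no such $t$ exists. *)

(* Defs.v *)
From HB Require Import structures.
From mathcomp Require Import all_boot all_order all_fingroup all_algebra.
From mathcomp Require Import all_classical all_reals all_analysis.
Set Implicit Arguments.
Unset Strict Implicit.
Unset Printing Implicit Defensive.
Import Order.TTheory GRing.Theory Num.Theory.
Import numFieldNormedType.Exports.
Local Open Scope classical_set_scope.
Local Open Scope ring_scope.

Record graph3 (T : finType) := Graph3 {
  edges : {set {set T}};
  edges_card3 : [forall e in edges, #|e| == 3%N] }.

HB.instance Definition _ (T : finType) := [isSub for @edges T].
HB.instance Definition _ (T : finType) := [Finite of graph3 T by <:].

Record fin_graph3 := FinGraph3 {
  vertices : finType;
  graph3_of :> graph3 vertices }.

(* classical_sets.set is universe-monomorphic, at a level too low for a set of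
   graphs over arbitrary finite types. *)
Definition graph_family := fin_graph3 -> Prop.

Definition single (F : fin_graph3) : graph_family := fun F' => F' = F.

Definition contains3 (T U : finType) (F : graph3 T) (H : graph3 U) : Prop :=
  exists2 f : T -> U, injective f &
    forall e, e \in edges F -> (f @: e)%SET \in edges H.

Definition free3 (Fs : graph_family) (U : finType) (H : graph3 U) : Prop :=
  forall F : fin_graph3, Fs F -> ~ contains3 F H.

Definition ex3 (n : nat) (Fs : graph_family) : nat :=
  (\max_(H : graph3 'I_n | `[< free3 Fs H >]) #|edges H|)%N.

Definition turan_ratio (R : realType) (Fs : graph_family) (n : nat) : R :=
  (ex3 n Fs)%:R / 'C(n, 3)%:R.

Definition turan_density (R : realType) (Fs : graph_family) : R :=
  limn (turan_ratio R Fs).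

Definition relabel (n : nat) (s : {perm 'I_n}) (H : graph3 'I_n) :
  {set {set 'I_n}} := [set s @: (e : {set 'I_n}) | e in edges H]%SET.

Definition edit_dist (T : finType) (A B : {set {set T}}) : nat :=
  #|(A :\: B) :|: (B :\: A)|.

Definition stable (R : realType) (Fs : graph_family) (t : nat) : Prop :=
  exists G : 'I_t -> forall m : nat, graph3 'I_m,
  forall delta : R, 0 < delta ->
  exists eps : R, 0 < eps /\ exists N0 : nat,
  forall (n : nat) (H : graph3 'I_n), (N0 <= n)%N -> free3 Fs H ->
    (1 - eps) * (ex3 n Fs)%:R < #|edges H|%:R ->
  exists (i : 'I_t) (s : {perm 'I_n}),
    (edit_dist (relabel s H) (edges (G i n)))%:R <= delta * n%:R ^+ 3.

(* The infimum of a nonempty set of naturals is its least element, and the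
   infimum of the empty set is +oo. *)
Definition stability_number (R : realType) (Fs : graph_family) : \bar R :=
  ereal_inf [set t%:R%:E | t in [set t : nat | (0 < t)%N /\ stable R Fs t]].

Definition prod3_edges (T U : finType) (G : graph3 T) (H : graph3 U) :
    {set {set (T * U)}} :=
  [set e : {set (T * U)} | [&& #|e| == 3%N,
     ([set p.1 | p in e])%SET \in edges G &
     ([set p.2 | p in e])%SET \in edges H]]%SET.

Lemma prod3_card3 (T U : finType) (G : graph3 T) (H : graph3 U) :
  [forall e in prod3_edges G H, #|e| == 3%N].
Proof. by apply/forall_inP => e; rewrite inE => /and3P[]. Qed.

Definition prod3 (T U : finType) (G : graph3 T) (H : graph3 U) :
  graph3 (T * U)%type := Graph3 (prod3_card3 G H).

Lemma mem_prod3 (T U : finType) (G : graph3 T) (H : graph3 U)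
    (x1 x2 x3 : T) (y1 y2 y3 : U) :
  ([set (x1, y1); (x2, y2); (x3, y3)]%SET \in edges (prod3 G H)) =
  ([set x1; x2; x3]%SET \in edges G) && ([set y1; y2; y3]%SET \in edges H).
Proof.
rewrite inE !imsetU !imset_set1 /=; case: (boolP (_ \in edges G)) => [xG|_];
  last by rewrite andbF.
suff -> : #|[set (x1, y1); (x2, y2); (x3, y3)]%SET| == 3%N by [].
have /eqP x3E := forall_inP (edges_card3 G) _ xG.
rewrite eqn_leq -{2}x3E; apply/andP; split.
  apply: leq_trans (leq_card_setU _ _) _; rewrite cards1 addn1 ltnS.
  by rewrite cards2; case: (_ != _).
have -> : [set x1; x2; x3]%SET =
    [set p.1 | p in [set (x1, y1); (x2, y2); (x3, y3)]%SET]%SET.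
  by rewrite !imsetU !imset_set1.
exact: leq_imset_card.
Qed.

(* Vertex i of 'I_n carries the label i + 1, so labels run over 1, ..., n. *)
Definition labelled_edges (n : nat) (E : seq (seq nat)) : {set {set 'I_n}} :=
  [set:: [seq [set i : 'I_n | i.+1 \in s]%SET | s <- E]].

Lemma labelled_card3 (n : nat) (E : seq (seq nat)) :
  all (fun s => count (fun i => i.+1 \in s) (iota 0 n) == 3%N) E ->
  [forall e in labelled_edges n E, #|e| == 3%N].
Proof.
move=> /allP cE; apply/forall_inP => e; rewrite inE => /mapP[s sE ->].
rewrite -(eqP (cE s sE)) cardsE cardE size_filter -enumT -val_enum_ord.
by rewrite count_map.
Qed.

(* Labels 1, 2, 3, 4 stand for a, b, c, d. *)
Definition K4minus : graph3 'I_4 :=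
  Graph3 (@labelled_card3 4
    [:: [:: 1; 2; 3]; [:: 1; 2; 4]; [:: 1; 3; 4]]%N isT).

Definition Fstar : graph3 'I_7 :=
  Graph3 (@labelled_card3 7
    [:: [:: 1; 2; 3]; [:: 1; 2; 4]; [:: 3; 4; 5]; [:: 1; 5; 6];
        [:: 2; 5; 7]]%N isT).

Definition F_K4minus_Fstar : fin_graph3 := FinGraph3 (prod3 K4minus Fstar).

(* Main.v *)
(* Upper bound.  A 3-graph admitting no homomorphism from F is K4-minus-free and
   contains no homomorphic image of F*.  Put integer weights of total n on its
   vertices so as to maximise the weighted number of edges, with the smallest
   possible support.  Shifting weight between two vertices not covered by an
   edge shows that the support is 2-covering; there, two edges sharing a pair
   would yield K4-minus or F*, so the edges in the support form a linear
   3-graph.  In a linear 3-graph the link of a heaviest vertex has weight at most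
   n^2/9, and at a maximum all link weights agree up to O(n), whence at most
   n^3/27 + O(n^2) edges.  A denser 3-graph therefore has, by sampling m-tuples, a
   positive density of homomorphic copies of F along one fixed map V(F) -> [m],
   and Erdos' box theorem turns these into an embedded copy of F.

   Lower bound and instability.  Take classes A_0, A_1 and B_pq (p, q bits) and
   let the edges be the triples with one vertex in A_i and two vertices in
   B-classes that differ in bit i.  A finite search shows that F has no
   homomorphism to this pattern.  When |A_0| + |A_1| = n/3 and the B-classes have
   size n/6, the blow-up has n^3/27 edges however A is split, but the sum of
   squared codegrees, which an edit of one edge changes by O(n), depends on the
   split at order n^4. *)

Require Import Defs.
From mathcomp Require Import all_boot all_fingroup zify.
Set Implicit Arguments.
Unset Strict Implicit.
Unset Printing Implicit Defensive.

(** * Adjacency in 3-graphs *)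

Definition adj (T : finType) (H : {set {set T}}) (x y z : T) : bool :=
  [set x; y; z] \in H.

Lemma adj_swap (T : finType) (H : {set {set T}}) x y z :
  adj H x y z = adj H y x z.
Proof. by rewrite /adj (setUC [set x]). Qed.

Lemma adj_rot (T : finType) (H : {set {set T}}) x y z :
  adj H x y z = adj H y z x.
Proof. by rewrite /adj -setUA setUC. Qed.

Lemma adj_irr (T : finType) (H : graph3 T) x y : adj (edges H) x x y = false.
Proof.
apply/negP => /(forall_inP (edges_card3 H)).
by rewrite setUid cards2; case: (_ != _).
Qed.

Lemma cards3P (T : finType) (e : {set T}) : #|e| = 3 ->
  exists a b c, [/\ a != b, a != c, b != c & e = [set a; b; c]].
Proof.
move=> e3; have /set0Pn[a ea] : e != set0 by rewrite -card_gt0 e3.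
have /cards2P[b [c [bc ebc]]] : #|e :\ a| == 2.
  by have /eqP := cardsD1 a e; rewrite ea e3 add1n eqSS eq_sym.
have D t : (t \in e :\ a) = (t \in [set b; c]) by rewrite ebc.
exists a, b, c; have := D b; have := D c; have := D a; rewrite !inE !eqxx /= !orbT.
move=> /esym/norP[ab ac] /andP[_ ec] /andP[_ eb].
by rewrite -setUA -ebc setD1K.
Qed.

Lemma set3_card (T : finType) (x y z : T) :
  (#|[set x; y; z]| == 3) = [&& x != y, x != z & y != z].
Proof.
rewrite setUC cardsU1 cards2 !inE (eq_sym z x) (eq_sym z y) negb_or.
by case: (x != y); case: (x != z); case: (y != z).
Qed.

Lemma set3_eqP (T : finType) (a b c x y z : T) :
    a != b -> a != c -> b != c ->
  ([set x; y; z] == [set a; b; c]) =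
  ((x, y, z) \in [:: (a, b, c); (a, c, b); (b, a, c); (b, c, a); (c, a, b);
                     (c, b, a)]).
Proof.
move=> ab ac bc; apply/idP/idP => [/eqP E|].
  have : #|[set x; y; z]| == 3 by rewrite E set3_card ab ac bc.
  rewrite set3_card => /and3P[xy xz yz].
  have D t : t \in [set x; y; z] -> [|| t == a, t == b | t == c].
    by rewrite E !inE orbA.
  have xD : [|| x == a, x == b | x == c] by apply: D; rewrite !inE eqxx.
  have yD : [|| y == a, y == b | y == c] by apply: D; rewrite !inE eqxx orbT.
  have zD : [|| z == a, z == b | z == c] by apply: D; rewrite !inE eqxx !orbT.
  clear E D; case/or3P: xD => /eqP xE; case/or3P: yD => /eqP yE;
    rewrite xE yE ?eqxx // in xy *; case/or3P: zD => /eqP zE;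
    rewrite xE yE zE ?eqxx // in xz yz *; by rewrite !inE eqxx ?orbT.
have sw u v w : [set u; v; w] = [set v; u; w].
  by rewrite (setUC [set u]).
have ro u v w : [set u; v; w] = [set v; w; u].
  by rewrite -setUA setUC.
rewrite !inE => /or4P[|||/or3P[]] /eqP[-> -> ->]; apply/eqP => //.
- by rewrite sw ro.
- by rewrite sw.
- by rewrite -ro.
- by rewrite ro.
- by rewrite sw -ro.
Qed.

(** Double counting of the pairs formed by an edge and one of its six orderings. *)
Lemma sum_adj (T : finType) (H : {set {set T}}) :
    (forall e, e \in H -> #|e| = 3) ->
  \sum_x \sum_y \sum_z adj H x y z = 6 * #|H|.
Proof.
move=> H3.
have -> : \sum_x \sum_y \sum_z adj H x y z =
    \sum_(p : T * T * T) adj H p.1.1 p.1.2 p.2.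
  rewrite pair_bigA /=.
  by rewrite (pair_bigA _ (fun p z => nat_of_bool (adj H p.1 p.2 z))).
have -> : 6 * #|H| = \sum_(e in H) 6 by rewrite sum_nat_const mulnC.
transitivity (\sum_(p : T * T * T) \sum_(e in H)
   ([set p.1.1; p.1.2; p.2] == e)).
  apply: eq_bigr => p _; rewrite /adj.
  case: (boolP (_ \in H)) => pH.
    rewrite (bigD1 [set p.1.1; p.1.2; p.2]) //= eqxx big1 // => e.
    by rewrite eq_sym => /andP[_ /negPf ->].
  by rewrite big1 // => e eH; case: eqP => // pe; rewrite pe eH in pH.
rewrite exchange_big /=; apply: eq_bigr => e /H3.
move=> /cards3P[a [b [c [ab ac bc ->]]]].
transitivity (\sum_(p : T * T * T)
    (p \in [:: (a, b, c); (a, c, b); (b, a, c); (b, c, a); (c, a, b);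
                     (c, b, a)])).
  by apply: eq_bigr => -[[x y] z] _; rewrite set3_eqP.
rewrite -big_mkcond /= sum1_card; apply/card_uniqP.
by rewrite /= !inE !xpair_eqE !eqxx (eq_sym b a) (eq_sym c a) (eq_sym c b)
  (negPf ab) (negPf ac) (negPf bc).
Qed.

(** * Integer weights on linear 3-graphs *)

(** The swap and the rotation generate all permutations of the arguments. Working with relations
    lets edge sets, samples along tuples and blow-ups share one theory. *)
Definition graph_rel (V : finType) (E : V -> V -> V -> bool) : Prop :=
  [/\ forall x y z, E x y z = E y x z, forall x y z, E x y z = E y z x
    & forall x y, E x x y = false].

Lemma adj_graph_rel (T : finType) (H : graph3 T) : graph_rel (adj (edges H)).
Proof.
split=> *; [exact: adj_swap | exact: adj_rot | exact: adj_irr].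
Qed.

(** The trilinear form of [E]. For a [graph_rel], [tsum E w w w] is six times the weighted edge
    count, and [tsum E (delta u) w w] is twice the weight of the link of [u]. *)
Definition tsum (V : finType) (E : V -> V -> V -> bool) (f g h : V -> nat) :=
  \sum_x \sum_y \sum_z E x y z * (f x * g y * h z).

Definition delta (V : finType) (u : V) (x : V) : nat := x == u.

Lemma eq_tsum (V : finType) (E : V -> V -> V -> bool) f f' g g' h h' :
  f =1 f' -> g =1 g' -> h =1 h' -> tsum E f g h = tsum E f' g' h'.
Proof.
move=> ff gg hh; do 3![apply: eq_bigr => ? _]; by rewrite ff gg hh.
Qed.

Lemma tsum_swap (V : finType) (E : V -> V -> V -> bool) f g h :
  graph_rel E -> tsum E f g h = tsum E g f h.
Proof.
move=> [sw _ _]; rewrite /tsum exchange_big; do 3![apply: eq_bigr => ? _].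
by rewrite sw [f _ * _]mulnC.
Qed.

Lemma tsum_swapr (V : finType) (E : V -> V -> V -> bool) f g h :
  graph_rel E -> tsum E f g h = tsum E f h g.
Proof.
move=> [sw ro _]; rewrite /tsum; apply: eq_bigr => x _; rewrite exchange_big.
by do 2![apply: eq_bigr => ? _]; rewrite -ro sw mulnAC.
Qed.

Lemma tsumDl (V : finType) (E : V -> V -> V -> bool) f f' g h :
  tsum E (fun x => f x + f' x) g h = tsum E f g h + tsum E f' g h.
Proof.
rewrite /tsum; do 3![rewrite -big_split; apply: eq_bigr => ? _] => /=; lia.
Qed.

Lemma tsumZl (V : finType) (E : V -> V -> V -> bool) k f g h :
  tsum E (fun x => k * f x) g h = k * tsum E f g h.
Proof.
rewrite /tsum; do 3![rewrite big_distrr; apply: eq_bigr => ? _] => /=; lia.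
Qed.

Lemma tsum_delta (V : finType) (E : V -> V -> V -> bool) u g h :
  tsum E (delta u) g h = \sum_y \sum_z E u y z * (g y * h z).
Proof.
rewrite /tsum (bigD1 u) //= [X in _ + X]big1 ?addn0 => [|x /negPf xu].
  by do 2![apply: eq_bigr => ? _]; rewrite /delta eqxx mul1n.
by do 2![rewrite big1 // => ? _]; rewrite /delta xu mul0n muln0.
Qed.

Lemma tsum_delta2 (V : finType) (E : V -> V -> V -> bool) u v h :
  tsum E (delta u) (delta v) h = \sum_z E u v z * h z.
Proof.
rewrite tsum_delta (bigD1 v) //= [X in _ + X]big1 ?addn0 => [|x /negPf xu].
  by apply: eq_bigr => ? _; rewrite /delta eqxx mul1n.
by rewrite big1 // => ? _; rewrite /delta xu mul0n muln0.
Qed.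

Lemma tsum_delta_same (V : finType) (E : V -> V -> V -> bool) u h :
  graph_rel E -> tsum E (delta u) (delta u) h = 0.
Proof.
by move=> [_ _ ir]; rewrite tsum_delta2 big1 // => z _; rewrite ir.
Qed.

Lemma tsumDm (V : finType) (E : V -> V -> V -> bool) e f g h :
    graph_rel E ->
  tsum E e (fun x => f x + g x) h = tsum E e f h + tsum E e g h.
Proof. by move=> gE; rewrite tsum_swap // tsumDl !(tsum_swap _ e). Qed.

Lemma tsumDr (V : finType) (E : V -> V -> V -> bool) e f g h :
    graph_rel E ->
  tsum E e h (fun x => f x + g x) = tsum E e h f + tsum E e h g.
Proof.
by move=> gE; rewrite tsum_swapr // tsumDm // !(tsum_swapr _ h).
Qed.

Lemma tsumZm (V : finType) (E : V -> V -> V -> bool) k e f h :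
  graph_rel E -> tsum E e (fun x => k * f x) h = k * tsum E e f h.
Proof. by move=> gE; rewrite tsum_swap // tsumZl (tsum_swap e). Qed.

Lemma tsumZr (V : finType) (E : V -> V -> V -> bool) k e f h :
  graph_rel E -> tsum E e h (fun x => k * f x) = k * tsum E e h f.
Proof. by move=> gE; rewrite tsum_swapr // tsumZm // (tsum_swapr e). Qed.

Definition set2w (V : finType) (w : V -> nat) (u v : V) (a b : nat) (x : V) :=
  if x == u then a else if x == v then b else w x.

Lemma set2wE (V : finType) (w : V -> nat) (u v : V) a b x : u != v ->
  set2w w u v a b x = a * delta u x + b * delta v x + set2w w u v 0 0 x.
Proof.
move=> uv; rewrite /set2w /delta; case: (eqVneq x u) => [->|_].
  by rewrite (negPf uv) muln1 muln0 !addn0.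
by case: (x == v); rewrite muln0 ?muln1 ?muln0 ?addn0.
Qed.

Lemma set2w_id (V : finType) (w : V -> nat) (u v : V) x :
  set2w w u v (w u) (w v) x = w x.
Proof. by rewrite /set2w; case: eqP => [->//|_]; case: eqP => [->|]. Qed.

Lemma sum_delta (V : finType) (u : V) : \sum_x delta u x = 1.
Proof.
by rewrite /delta (bigD1 u) //= eqxx big1 // => x /negPf ->.
Qed.

Lemma sum_set2w (V : finType) (w : V -> nat) (u v : V) a b : u != v ->
  \sum_x set2w w u v a b x = a + b + \sum_x set2w w u v 0 0 x.
Proof.
move=> uv; under eq_bigr do rewrite set2wE //.
by rewrite !big_split -!big_distrr /= !sum_delta !muln1.
Qed.

Lemma tsum_delta_set2w (V : finType) (E : V -> V -> V -> bool) w u v a b :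
    graph_rel E -> u != v ->
  tsum E (delta u) (set2w w u v a b) (set2w w u v a b) =
  tsum E (delta u) (set2w w u v 0 0) (set2w w u v 0 0)
  + 2 * b * tsum E (delta u) (delta v) (set2w w u v 0 0).
Proof.
move=> gE uv; have W x := set2wE w a b x uv.
rewrite (eq_tsum E (frefl _) W W); set w0 := set2w w u v 0 0.
set p := delta u; set q := delta v.
have pph h : tsum E p p h = 0 by apply: tsum_delta_same.
have php h : tsum E p h p = 0 by rewrite tsum_swapr.
have pqq : tsum E p q q = 0.
  by rewrite tsum_swap // tsum_swapr // tsum_delta_same.
have pwq : tsum E p w0 q = tsum E p q w0 by apply: tsum_swapr.
by do ![rewrite tsumDm // | rewrite tsumDr // | rewrite tsumZm //
  | rewrite tsumZr //]; rewrite !pph !php !pqq !pwq; lia.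
Qed.

(** No edge repeats a vertex, so the form is affine in the weight [a] of [u] and in the weight [b]
    of [v]. The two link identities are its partial derivatives at [w]. *)
Lemma tsum_set2w (V : finType) (E : V -> V -> V -> bool) w u v :
    graph_rel E -> u != v ->
  exists C A B D, [/\ forall a b,
      tsum E (set2w w u v a b) (set2w w u v a b) (set2w w u v a b) =
      C + a * A + b * B + a * b * D,
    3 * tsum E (delta u) w w = A + w v * D,
    3 * tsum E (delta v) w w = B + w u * D &
    D = 6 * tsum E (delta u) (delta v) (set2w w u v 0 0)].
Proof.
move=> gE uv; set w0 := set2w w u v 0 0.
exists (tsum E w0 w0 w0), (3 * tsum E (delta u) w0 w0),
  (3 * tsum E (delta v) w0 w0), (6 * tsum E (delta u) (delta v) w0).
have Ew x := esym (set2w_id w u v x).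
have sww a b x : set2w w u v a b x = set2w w v u b a x.
  by rewrite /set2w; case: (eqVneq x u) => // ->; rewrite (negPf uv).
have vu : v != u by rewrite eq_sym.
have Lv a b : tsum E (delta v) (set2w w u v a b) (set2w w u v a b) =
  tsum E (delta v) w0 w0 + 2 * a * tsum E (delta u) (delta v) w0.
  rewrite (eq_tsum E (frefl _) (sww a b) (sww a b)) tsum_delta_set2w //.
  rewrite (tsum_swap (delta v) (delta u)) //.
  have w0s x : set2w w v u 0 0 x = w0 x by apply/esym/sww.
  by congr (_ + _ * _); apply: eq_tsum => //.
split=> //; last first.
- by rewrite (eq_tsum E (frefl _) Ew Ew) Lv; lia.
- by rewrite (eq_tsum E (frefl _) Ew Ew) tsum_delta_set2w // -/w0; lia.
move=> a b; set W := set2w w u v a b; have WE x := set2wE w a b x uv.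
rewrite (eq_tsum E WE WE WE) -/w0.
set p := delta u; set q := delta v.
have pph h : tsum E p p h = 0 by apply: tsum_delta_same.
have qqh h : tsum E q q h = 0 by apply: tsum_delta_same.
have php h : tsum E p h p = 0 by rewrite tsum_swapr.
have qhq h : tsum E q h q = 0 by rewrite tsum_swapr.
have hpp h : tsum E h p p = 0 by rewrite tsum_swap.
have hqq h : tsum E h q q = 0 by rewrite tsum_swap.
have qph h : tsum E q p h = tsum E p q h by apply: tsum_swap.
have pwq : tsum E p w0 q = tsum E p q w0 by apply: tsum_swapr.
have qwp : tsum E q w0 p = tsum E p q w0 by rewrite tsum_swapr.
have wpq : tsum E w0 p q = tsum E p q w0 by rewrite tsum_swap.
have wqp : tsum E w0 q p = tsum E p q w0 by rewrite tsum_swap.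
have wpw : tsum E w0 p w0 = tsum E p w0 w0 by apply: tsum_swap.
have wqw : tsum E w0 q w0 = tsum E q w0 w0 by apply: tsum_swap.
have wwp : tsum E w0 w0 p = tsum E p w0 w0 by rewrite tsum_swapr.
have wwq : tsum E w0 w0 q = tsum E q w0 w0 by rewrite tsum_swapr.
do ![rewrite tsumDl | rewrite tsumDm // | rewrite tsumDr // | rewrite tsumZl
  | rewrite tsumZm // | rewrite tsumZr //].
rewrite ?(pph, qqh, php, qhq, hpp, hqq).
rewrite ?(qph, pwq, qwp, wpq, wqp, wpw, wqw, wwp, wwq); lia.
Qed.

(** * Maximal weights of least support *)

Definition support_of (V : finType) (w : V -> nat) : {set V} :=
  [set x | 0 < w x].

Definition maximal_weight (V : finType) (E : V -> V -> V -> bool)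
    (w : V -> nat) : Prop :=
  forall w', \sum_x w' x = \sum_x w x ->
  tsum E w' w' w' <= tsum E w w w /\
  (tsum E w' w' w' = tsum E w w w -> #|support_of w| <= #|support_of w'|).

(** Only finitely many weights have a given total, so a lexicographic optimum exists. *)
Lemma maximal_weight_exists (V : finType) (E : V -> V -> V -> bool)
    (w0 : V -> nat) :
  exists2 w, \sum_x w x = \sum_x w0 x & maximal_weight E w.
Proof.
set n := \sum_x w0 x.
pose code (w : V -> nat) : {ffun V -> 'I_n.+1} := [ffun x => inord (w x)].
have codeK w : \sum_x w x = n -> forall x, code w x = w x :> nat.
  by move=> wn x; rewrite ffunE inordK // ltnS -wn (bigD1 x) //= leq_addr.
pose dec (w : {ffun V -> 'I_n.+1}) (x : V) : nat := w x.
(* The factor [#|V|.+1] exceeds the second summand, so the score compares edge weights first and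
   then prefers the smaller support. *)
pose score (w : {ffun V -> 'I_n.+1}) :=
  tsum E (dec w) (dec w) (dec w) * #|V|.+1 + (#|V| - #|support_of (dec w)|).
have score_code w : \sum_x w x = n -> score (code w) =
    tsum E w w w * #|V|.+1 + (#|V| - #|support_of w|).
  move=> wn; have cK := codeK _ wn; rewrite /score (eq_tsum E cK cK cK).
  suff -> : support_of (dec (code w)) = support_of w by [].
  by apply/setP => x; rewrite !inE /dec cK.
pose sumn_ok (w : {ffun V -> 'I_n.+1}) := \sum_x (w x : nat) == n.
have ok0 : sumn_ok (code w0).
  by apply/eqP; apply: eq_bigr => x _; apply: codeK.
have [w /eqP wn wmax] := arg_maxnP score ok0.
exists (dec w) => // w'; rewrite wn => w'n.
have := wmax (code w'); rewrite score_code //.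
have -> : sumn_ok (code w').
  by apply/eqP; rewrite -[RHS]w'n; apply: eq_bigr => x _; apply: codeK.
move=> /(_ isT); rewrite /score.
set P := tsum E w' w' w'; set Q := tsum E _ _ _.
have := max_card (support_of (dec w)); have := max_card (support_of w').
set s' := #|support_of w'|; set s := #|support_of (dec w)|; set N := #|V|.
move: P Q s s' N => P Q s s' N h1 h2; rewrite /geq /= => h3.
split=> [|h4]; last by rewrite h4 leq_add2l in h3; lia.
by rewrite leqNgt; apply/negP => lt; have := leq_mul lt (leqnn N.+1); nia.
Qed.

(* Moving one unit of weight from [v] to [u] cannot increase the edge weight. *)
Lemma leq_max_weight (V : finType) (E : V -> V -> V -> bool) w u v :
    graph_rel E -> maximal_weight E w -> 0 < w v ->
  tsum E (delta u) w w <= tsum E (delta v) w w + 2 * \sum_x w x.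
Proof.
move=> gE wmax wv; have [->|uv] := eqVneq u v; first exact: leq_addr.
have [C [A [B [D [Pw Lu Lv DE]]]]] := tsum_set2w w gE uv.
have sw : \sum_x w x = w u + w v + \sum_x set2w w u v 0 0 x.
  by rewrite -sum_set2w //; apply: eq_bigr => x _; rewrite set2w_id.
have [] := wmax (set2w w u v (w u).+1 (w v).-1).
  by rewrite sum_set2w // sw; lia.
rewrite Pw => + _; have Ew x := esym (set2w_id w u v x).
rewrite (eq_tsum E Ew Ew Ew) Pw => le1.
(* The transfer changes the form by three times the difference of the two link sums, minus [D]. As
   [D] is six times the codegree weight bounded here, dividing by three gives the constant 2. *)
have : tsum E (delta u) (delta v) (set2w w u v 0 0) <= \sum_x w x.
  rewrite tsum_delta2 sw; apply: leq_trans (leq_addl _ _).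
  by apply: leq_sum => z _; case: (E u v z); rewrite ?mul1n.
by case: (w v) wv le1 Lu Lv sw => //= k _ le1 Lu Lv sw; nia.
Qed.

(** If no edge of the support contained [u] and [v], then [D = 0] and the form would be affine along
    transfers between them. One of the two extreme transfers would lose nothing and shrink the
    support. *)
Lemma maximal_weight_cover (V : finType) (E : V -> V -> V -> bool) w u v :
    graph_rel E -> maximal_weight E w -> u != v -> 0 < w u -> 0 < w v ->
  exists2 z, 0 < w z & E u v z.
Proof.
move=> gE wmax uv wu wv.
have [/existsP[z /andP[]]|] := boolP [exists z, (0 < w z) && E u v z].
  by exists z.
move/existsPn => no; exfalso.
have [C [A [B [D [Pw _ _ DE]]]]] := tsum_set2w w gE uv.
have D0 : D = 0.
  rewrite DE tsum_delta2 big1 // => z _; have := no z; rewrite negb_and -eqn0Ngt.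
  case/orP => [/eqP wz|/negPf -> //]; rewrite /set2w wz.
  by do ![case: (_ == _)]; rewrite muln0.
have sw : \sum_x w x = w u + w v + \sum_x set2w w u v 0 0 x.
  by rewrite -sum_set2w //; apply: eq_bigr => x _; rewrite set2w_id.
have Ew x := esym (set2w_id w u v x).
have shift a b c : a + b = w u + w v -> (c == u) || (c == v) ->
    set2w w u v a b c = 0 ->
    tsum E (set2w w u v a b) (set2w w u v a b) (set2w w u v a b) <
    tsum E w w w.
  move=> ab cuv c0; have [] := wmax (set2w w u v a b).
    by rewrite sum_set2w // sw ab.
  rewrite leq_eqVlt => /orP[/eqP -> /(_ erefl)|//]; rewrite leqNgt => /negP[].
  apply/proper_card/properP; split.
    apply/subsetP => x; rewrite !inE /set2w; case: (eqVneq x u) => [->//|_].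
    by case: (eqVneq x v) => [->//|_].
  by exists c; rewrite !inE ?c0 //; case/orP: cuv => /eqP ->.
have c1 : set2w w u v (w u + w v) 0 v = 0.
  by rewrite /set2w eq_sym (negPf uv) eqxx.
have c2 : set2w w u v 0 (w u + w v) u = 0 by rewrite /set2w eqxx.
have := shift _ _ v (addn0 _) _ c1; have := shift _ _ u (add0n _) _ c2.
rewrite !eqxx orbT => /(_ isT) + /(_ isT).
rewrite !Pw (eq_tsum E Ew Ew Ew) Pw D0.
by case/orP: (leq_total A B); nia.
Qed.

Definition K4minus_free_rel (V : finType) (E : V -> V -> V -> bool) : Prop :=
  forall a b c d, E a b c -> E a b d -> E a c d -> False.

(** Vertices such as [f] and [c] may coincide, so all homomorphic images of F* are excluded; the
    covering argument below can produce degenerate ones. *)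
Definition Fstar_free_rel (V : finType) (E : V -> V -> V -> bool) : Prop :=
  forall a b c d e f g,
    E a b c -> E a b d -> E c d e -> E a e f -> E b e g -> False.

(** Cover the pair [z], [z'] by an edge with third vertex [t]. If [t] is [x] or [y], three triples
    on [x, y, z, z'] form K4-minus. Otherwise cover [x, t] by [f] and [y, t] by [g]: then
    [x, y, z, z', t, f, g] play the vertices 1 to 7 of F*. *)
Lemma maximal_weight_linear (V : finType) (E : V -> V -> V -> bool) w x y z z' :
    graph_rel E -> K4minus_free_rel E -> Fstar_free_rel E ->
    maximal_weight E w -> 0 < w x -> 0 < w y -> 0 < w z -> 0 < w z' ->
  E x y z -> E x y z' -> z = z'.
Proof.
move=> gE K4 Fs wmax wx wy wz wz' Exyz Exyz'; apply/eqP/negPn/negP => zz'.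
have [sw ro ir] := gE.
have [t wt Et] := maximal_weight_cover gE wmax zz' wz wz'.
have xt : x != t.
  apply/negP => /eqP xt; rewrite -xt in Et.
  by apply: (K4 x y z z') => //; rewrite ro.
have yt : y != t.
  apply/negP => /eqP yt; rewrite -yt in Et.
  by apply: (K4 y x z z'); rewrite ?(sw y x) //; rewrite ro.
have [f _ Ef] := maximal_weight_cover gE wmax xt wx wt.
have [g _ Eg] := maximal_weight_cover gE wmax yt wy wt.
exact: (Fs x y z z' t f g).
Qed.

(** By linearity the link of [i] is a matching on the support. With [m = w i], its sum is at most
    [m * (n - m)] since partners weigh at most [m], and at most [(n - m) ^ 2 / 2] by the AM-GM
    inequality. The first bound suffices when [3 * m <= n], the second otherwise. *)
Lemma maximal_weight_link (V : finType) (E : V -> V -> V -> bool) w i :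
    graph_rel E -> K4minus_free_rel E -> Fstar_free_rel E ->
    maximal_weight E w -> 0 < w i -> (forall x, w x <= w i) ->
  9 * tsum E (delta i) w w <= 2 * (\sum_x w x) ^ 2.
Proof.
move=> gE K4 Fs wmax wi0 wi; have [sw ro ir] := gE.
set n := \sum_x w x; set m := w i.
have nE : n = m + \sum_(x | x != i) w x by rewrite /n (bigD1 i).
(* For [y] in the support, [s y] is the weight of its partner in the matching, or 0 if there is
   none. *)
pose s y := \sum_z E i y z * w z.
have irz y : E i y i = false by rewrite ro ro ir.
have sP y : 0 < w y -> y != i -> s y <= m /\ w y + s y <= n - m.
  move=> wy yi; rewrite nE addKn.
  have [/existsP[z /andP[wz Ez]]|/existsPn no] :=
    boolP [exists z, (0 < w z) && E i y z].
    have zi : z != i by apply: contraTneq Ez => ->; rewrite irz.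
    have zy : z != y by apply: contraTneq Ez => ->; rewrite ro ir.
    have -> : s y = w z.
      rewrite /s (bigD1 z) //= Ez mul1n big1 ?addn0 // => t tz.
      case: (posnP (w t)) => [->|wt]; first by rewrite muln0.
      case: (boolP (E i y t)) => // Et.
      have zt := maximal_weight_linear gE K4 Fs wmax wi0 wy wz wt Ez Et.
      by rewrite zt eqxx in tz.
    split; first exact: wi.
    by rewrite (bigD1 y) //= leq_add2l (bigD1 z) ?zi //= leq_addr.
  have -> : s y = 0.
    rewrite /s big1 // => z _; have := no z; rewrite negb_and -eqn0Ngt.
    by case/orP => [/eqP ->|/negPf ->]; rewrite ?muln0.
  by rewrite addn0 (bigD1 y) //= leq_addr.
have LE : tsum E (delta i) w w = \sum_(y | y != i) w y * s y.
  rewrite tsum_delta (bigD1 i) //= big1 ?add0n => [|z _]; last by rewrite ir.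
  by apply: eq_bigr => y _; rewrite big_distrr /=; apply: eq_bigr => z _; lia.
have L1 : tsum E (delta i) w w <= m * (n - m).
  rewrite LE nE addKn big_distrr /=; apply: leq_sum => y yi.
  case: (posnP (w y)) => [->|wy]; first by rewrite muln0.
  by rewrite mulnC leq_mul2r (sP _ wy yi).1 orbT.
(* Distinct vertices have distinct partners, so no weight is counted twice. *)
have S2 : \sum_(y | (y != i) && (0 < w y)) s y <= n - m.
  rewrite /s exchange_big /= (bigD1 i) //= big1 ?add0n => [|y _]; last by rewrite irz.
  rewrite nE addKn; apply: leq_sum => z zi; case: (posnP (w z)) => [->|wz].
    by rewrite big1 // => ? _; rewrite muln0.
  rewrite -big_distrl /= -[leqRHS]mul1n leq_mul2r; apply/orP; right.
  have [/existsP[y /andP[/andP[yi wy] Ey]]|/existsPn no] :=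
    boolP [exists y, (y != i) && (0 < w y) && E i y z].
    rewrite (bigD1 y) ?yi //= Ey big1 // => t /andP[/andP[ti wt] ty].
    case: (boolP (E i t z)) => // Et.
    have Ey' : E i z y by rewrite -ro sw.
    have Et' : E i z t by rewrite -ro sw.
    have yt := maximal_weight_linear gE K4 Fs wmax wi0 wz wy wt Ey' Et'.
    by rewrite yt eqxx in ty.
  rewrite big1 // => y /andP[yi wy]; have := no y.
  by rewrite yi wy /= => /negPf ->.
have L2 : 4 * tsum E (delta i) w w <= 2 * (n - m) ^ 2.
  rewrite LE (bigID (fun y => 0 < w y)) /=.
  rewrite [X in _ + X]big1 ?addn0 => [|y /andP[_]]; last first.
    by rewrite -eqn0Ngt => /eqP ->.
  have -> : 2 * (n - m) ^ 2 = (n - m) * ((n - m) + (n - m)) by lia.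
  apply: leq_trans (_ : _ <= (n - m) *
      (\sum_(y | (y != i) && (0 < w y)) (w y + s y))) _; last first.
    rewrite leq_mul2l big_split /= leq_add ?orbT // nE addKn.
    rewrite [leqRHS](bigID (fun y => 0 < w y)) /=; exact: leq_addr.
  rewrite !big_distrr /=; apply: leq_sum => y /andP[yi wy].
  have [_ h] := sP _ wy yi; apply: (@leq_trans ((w y + s y) ^ 2)).
    exact: nat_AGM2.
  by rewrite expnS expn1 leq_mul2r h orbT.
have : m <= n by rewrite nE leq_addr.
by case: (leqP (3 * m) n); nia.
Qed.

(** The constant weight 1 counts ordered edges, and a maximal weight of the same total does at least
    as well. Each link sum exceeds that of a heaviest vertex by at most [2 * #|V|], which gives the
    error [18 * #|V| ^ 2]. *)
Lemma free_rel_bound (V : finType) (E : V -> V -> V -> bool) :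
    graph_rel E -> K4minus_free_rel E -> Fstar_free_rel E ->
  9 * \sum_x \sum_y \sum_z E x y z <= 2 * #|V| ^ 3 + 18 * #|V| ^ 2.
Proof.
move=> gE K4 Fs.
have [w wn wmax] := maximal_weight_exists E (fun _ : V => 1).
have {}wn : \sum_x w x = #|V| by rewrite wn sum1_card.
set n := #|V| in wn *.
have -> : \sum_x \sum_y \sum_z E x y z =
  tsum E (fun _ => 1) (fun _ => 1) (fun _ => 1).
  by rewrite /tsum; do 3![apply: eq_bigr => ? _]; rewrite !muln1.
have [|h _] := wmax (fun _ => 1); first by rewrite wn sum1_card.
apply: leq_trans (leq_mul (leqnn 9) h) _.
case: (posnP n) => [n0|n_gt0].
  rewrite /tsum big1 // => x _; have := max_card (pred1 x).
  by rewrite -/n n0 card1.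
have /existsP[i0 wi0] : [exists i, 0 < w i].
  apply/existsPn => no; move: n_gt0; rewrite -wn big1 // => x _.
  by apply/eqP; rewrite eqn0Ngt.
have [i _ wi] := arg_maxnP w (isT : predT i0).
have wi_gt0 : 0 < w i by apply: leq_trans wi0 (wi _ _).
have L := maximal_weight_link gE K4 Fs wmax wi_gt0 (fun x => wi x isT).
have -> : tsum E w w w = \sum_x w x * tsum E (delta x) w w.
  rewrite {1}/tsum; apply: eq_bigr => x _; rewrite tsum_delta.
  by do 2![rewrite big_distrr /=; apply: eq_bigr => ? _]; lia.
have : \sum_x w x * tsum E (delta x) w w <=
    n * (tsum E (delta i) w w + 2 * n).
  rewrite -[X in X * (_ + _)]wn big_distrl /=; apply: leq_sum => x _.
  by rewrite leq_mul2l -wn leq_max_weight ?orbT.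
rewrite wn -/n in L; nia.
Qed.

(** * Homomorphisms from F *)

Definition hom3 (T V : finType) (F : graph3 T) (E : V -> V -> V -> bool)
    (h : T -> V) : Prop :=
  forall x y z, adj (edges F) x y z -> E (h x) (h y) (h z).

Lemma labelled_adjP (n : nat) (L : seq (seq nat)) (x y z : 'I_n) :
    [forall e in labelled_edges n L, #|e| == 3] ->
    adj (labelled_edges n L) x y z ->
  uniq [:: x.+1; y.+1; z.+1] /\
  exists2 s, s \in L & all (mem s) [:: x.+1; y.+1; z.+1].
Proof.
move=> /forall_inP L3 xyz; have := L3 _ xyz.
rewrite set3_card /= !inE !eqSS !val_eqE => /and3P[xy xz yz].
rewrite negb_or xy xz yz; split=> //.
move: xyz; rewrite /adj inE => /mapP[s sL /setP sE].
exists s => //; rewrite -/(all (mem s) [:: x.+1; y.+1; z.+1]).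
apply/allP => t; rewrite !inE.
by case/or3P => /eqP ->; [have := sE x | have := sE y | have := sE z];
  rewrite !inE eqxx ?orbT => /esym.
Qed.

Lemma graph_rel_perm (V : finType) (E : V -> V -> V -> bool) (g : nat -> V)
    (p q r x y z : nat) :
    graph_rel E -> E (g p) (g q) (g r) ->
    uniq [:: x; y; z] -> all (mem [:: p; q; r]) [:: x; y; z] ->
  E (g x) (g y) (g z).
Proof.
move=> [sw ro _] pqr; rewrite /= !inE negb_or !andbT.
case/andP=> /andP[xy xz] yz.
move=> /and3P[/or3P[]/eqP xE /or3P[]/eqP yE /or3P[]/eqP zE]; subst x y z;
  move: xy xz yz; rewrite ?eqxx // => _ _ _.
- by rewrite -ro sw.
- by rewrite sw.
- by rewrite -ro.
- by rewrite ro.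
- by rewrite sw -ro.
Qed.

(** By symmetry it is enough to check each listed edge in one order. *)
Lemma labelled_hom3 (V : finType) (E : V -> V -> V -> bool) (n : nat)
    (L : seq (seq nat)) (H : graph3 'I_n) (g : nat -> V) :
    graph_rel E -> edges H = labelled_edges n L ->
    (forall s, s \in L ->
       exists p q r, s = [:: p; q; r] /\ E (g p) (g q) (g r)) ->
  hom3 H E (fun i => g i.+1).
Proof.
move=> gE HL EL x y z; rewrite HL => xyz.
have L3 := edges_card3 H; rewrite HL in L3.
have [U [s sL A]] := labelled_adjP L3 xyz.
have [p [q [r [sE Epqr]]]] := EL s sL.
by apply: (graph_rel_perm gE Epqr) => //; rewrite sE in A.
Qed.

Lemma prod3_adj (T U : finType) (G : graph3 T) (H : graph3 U) p q r :
  adj (edges (prod3 G H)) p q r =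
  adj (edges G) p.1 q.1 r.1 && adj (edges H) p.2 q.2 r.2.
Proof. by case: p q r => [? ?] [? ?] [? ?]; exact: mem_prod3. Qed.

(** The projections of the product are homomorphisms onto its factors, so an image of either factor
    is also an image of F. *)
Lemma no_hom3_free (V : finType) (E : V -> V -> V -> bool) :
    graph_rel E -> (forall h, ~ hom3 (prod3 K4minus Fstar) E h) ->
  K4minus_free_rel E /\ Fstar_free_rel E.
Proof.
move=> gE no; split.
  move=> a b c d abc abd acd.
  (* The first entry is a dummy for label 0, since labels start at 1. *)
  pose g i := nth a [:: a; a; b; c; d] i.
  apply: (no (fun p => g p.1.+1)) => p q r; rewrite prod3_adj => /andP[K _].
  apply: (labelled_hom3 gE (erefl (edges K4minus))) K => s.
  rewrite !inE => /or3P[]/eqP ->; do 3!eexists; split; by [|].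
move=> a b c d e f g abc abd cde aef beg.
pose G i := nth a [:: a; a; b; c; d; e; f; g] i.
apply: (no (fun p => G p.2.+1)) => p q r; rewrite prod3_adj => /andP[_ K].
apply: (labelled_hom3 gE (erefl (edges Fstar))) K => s.
rewrite !inE => /or4P[|||/orP[]]/eqP ->; do 3!eexists; split; by [|].
Qed.

(** * The pattern of the lower bound and the exhaustive search *)

Definition bit (i : bool) (p : bool * bool) : bool := if i then p.2 else p.1.

(* [inl i] stands for the class A_i and [inr (p, q)] for the class B_pq. *)
Definition twist (x y z : bool + bool * bool) : bool :=
  match x, y, z with
  | inl i, inr p, inr q => bit i p != bit i q
  | inr p, inl i, inr q => bit i p != bit i q
  | inr p, inr q, inl i => bit i p != bit i q
  | _, _, _ => false
  end.

Lemma twist_graph_rel : graph_rel twist.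
Proof.
split; first by do 3![case=> [[]|[[] []]]].
  by do 3![case=> [[]|[[] []]]].
by do 2![case=> [[]|[[] []]]].
Qed.

(* The conditional, unlike [&&], keeps call-by-value evaluation from exploring
   refuted branches. *)
Fixpoint search (T : Type) (R : T -> T -> T -> bool) (t0 : T) (dom : seq T)
    (cs : seq (seq (nat * nat))) (asg : seq T) : bool :=
  if cs is c :: cs' then
    has (fun t =>
      if all (fun ij => R t (nth t0 asg ij.1) (nth t0 asg ij.2)) c
      then search R t0 dom cs' (t :: asg) else false) dom
  else true.

(** Each edge is checked when its last vertex is placed. Placed vertices are kept latest first, so
    positions in [done] agree with positions in the partial assignment of [search]. *)
Fixpoint constraints (V : Type) (A : V -> V -> V -> bool) (v0 : V)
    (done todo : seq V) : seq (seq (nat * nat)) :=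
  if todo is v :: todo' then
    [seq ij <- [seq (i, j) | i <- iota 0 (size done), j <- iota 0 i]
       | A v (nth v0 done ij.1) (nth v0 done ij.2)]
    :: constraints A v0 (v :: done) todo'
  else [::].

(** The branch that follows [f] passes every check, so a failing search rules out all
    homomorphisms. *)
Lemma search_complete (V T : eqType) (A : V -> V -> V -> bool)
    (R : T -> T -> T -> bool) v0 t0 (dom : seq T) (f : V -> T) done todo :
    (forall x y z, A x y z -> R (f x) (f y) (f z)) -> (forall t, t \in dom) ->
  search R t0 dom (constraints A v0 done todo) (map f done).
Proof.
move=> AR domT; elim: todo done => //= v todo IH done; apply/hasP.
exists (f v) => //; rewrite (IH (v :: done)); case: ifP => // /negP[].
apply/allP => -[i j].
rewrite mem_filter => /andP[Aij /allpairsPdep[i' [j' []]]].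
rewrite !mem_iota => i'lt j'lt [ii jj]; subst i' j'; move: Aij => /=.
by rewrite !(nth_map v0) //; [exact: AR | exact: ltn_trans j'lt _].
Qed.

Definition label_adj (L : seq (seq nat)) (i j k : nat) : bool :=
  has (perm_eq [:: i.+1; j.+1; k.+1]) L.

Lemma label_adj_adj n L (i j k : 'I_n) :
  label_adj L i j k -> adj (labelled_edges n L) i j k.
Proof.
case/hasP => s sL /perm_mem sE; rewrite /adj inE; apply/mapP; exists s => //.
by apply/setP => x; rewrite !inE -sE !inE !eqSS !val_eqE orbA.
Qed.

(** A copy of the edges of F on pairs of naturals, on which the search can compute; the range
    conditions make the passage to ordinals by [inord] faithful. *)
Definition F_label_adj (p q r : nat * nat) : bool :=
  [&& label_adj [:: [:: 1; 2; 3]; [:: 1; 2; 4]; [:: 1; 3; 4]] p.1 q.1 r.1,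
      label_adj [:: [:: 1; 2; 3]; [:: 1; 2; 4]; [:: 3; 4; 5]; [:: 1; 5; 6];
        [:: 2; 5; 7]] p.2 q.2 r.2,
      all (fun p => p < 4) [:: p.1; q.1; r.1] &
      all (fun p => p < 7) [:: p.2; q.2; r.2]].

(* This order keeps the search tree below 6200 nodes. *)
Definition F_order : seq (nat * nat) :=
  [:: (0, 0); (1, 1); (2, 2); (3, 1); (2, 3); (1, 2); (0, 4); (3, 3); (2, 1);
      (1, 3); (3, 2); (1, 6); (2, 6); (3, 6); (0, 1); (1, 0); (2, 0); (0, 2);
      (3, 0); (0, 3); (1, 4); (2, 4); (3, 4); (0, 5); (0, 6); (1, 5); (2, 5);
      (3, 5)].

(** A homomorphism would be a successful branch of the search over the six classes, and evaluation
    finds none. *)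
Lemma no_hom3_twist h : ~ hom3 (prod3 K4minus Fstar) twist h.
Proof.
move=> hom.
pose f (p : nat * nat) := h (inord p.1 : 'I_4, inord p.2 : 'I_7).
pose dom : seq (bool + bool * bool) := [:: inl false; inl true;
  inr (false, false); inr (false, true); inr (true, false); inr (true, true)].
have : search twist (inl true) dom (constraints F_label_adj (0, 0) [::] F_order)
    (map f [::]).
  apply: search_complete; last by case=> [[]|[[] []]].
  move=> p q r /and4P[K S]; rewrite /= !andbT.
  move=> /and3P[p1 q1 r1] /and3P[p2 q2 r2].
  apply: hom; rewrite prod3_adj /=; apply/andP; split.
    by apply: label_adj_adj; rewrite !inordK.
  by apply: label_adj_adj; rewrite !inordK.
suff -> : search twist (inl true) dom
  (constraints F_label_adj (0, 0) [::] F_order) (map f [::]) = false by [].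
by vm_compute.
Qed.

(** * From homomorphic density to copies *)

(** The sum over all [k]-tuples, set up so that splitting off the first coordinate is a computation,
    as the induction on [k] in [box_lemma] requires. *)
Fixpoint seqsum (V : finType) (k : nat) (f : seq V -> nat) : nat :=
  if k is k'.+1 then \sum_x seqsum k' (fun s => f (x :: s)) else f [::].

Lemma leq_seqsum (V : finType) k (f g : seq V -> nat) :
  (forall s, size s = k -> f s <= g s) -> seqsum k f <= seqsum k g.
Proof.
elim: k f g => [|k IH] f g fg /=; first exact: fg.
by apply: leq_sum => x _; apply: IH => s sk; apply: fg; rewrite /= sk.
Qed.

Lemma eq_seqsum (V : finType) k (f g : seq V -> nat) :
  (forall s, size s = k -> f s = g s) -> seqsum k f = seqsum k g.
Proof.
by move=> fg; apply/eqP; rewrite eqn_leq !leq_seqsum // => s /fg ->.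
Qed.

Lemma seqsumD (V : finType) k (f g : seq V -> nat) :
  seqsum k (fun s => f s + g s) = seqsum k f + seqsum k g.
Proof.
elim: k f g => //= k IH f g; rewrite -big_split /=.
by apply: eq_bigr => x _; rewrite IH.
Qed.

Lemma seqsumZ (V : finType) k c (f : seq V -> nat) :
  seqsum k (fun s => c * f s) = c * seqsum k f.
Proof.
elim: k f => //= k IH f; rewrite big_distrr /=.
by apply: eq_bigr => x _; rewrite IH.
Qed.

Lemma seqsum_const (V : finType) k c :
  seqsum k (fun _ : seq V => c) = #|V| ^ k * c.
Proof.
elim: k => [|k IH] /=; first by rewrite mul1n.
by rewrite IH sum_nat_const expnS mulnA.
Qed.

Lemma seqsum_sum (V I : finType) (P : pred I) k (f : I -> seq V -> nat) :
  seqsum k (fun s => \sum_(i | P i) f i s) = \sum_(i | P i) seqsum k (f i).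
Proof.
elim: k f => //= k IH f; rewrite exchange_big /=.
by apply: eq_bigr => x _; rewrite IH.
Qed.

(** Entries of a uniform tuple are uniform and independent. This lemma and the next two state it for
    one, two and three positions, with denominators cleared. *)
Lemma seqsum_nth1 (V : finType) (x0 : V) k i (f : V -> nat) : i < k ->
  #|V| * seqsum k (fun s => f (nth x0 s i)) = #|V| ^ k * \sum_x f x.
Proof.
elim: k i => // k IH [|i] ik /=.
  under eq_bigr do rewrite seqsum_const.
  by rewrite -big_distrr /= expnS mulnA.
by rewrite sum_nat_const IH // expnS mulnA.
Qed.

Lemma seqsum_nth2 (V : finType) (x0 : V) k i j (f : V -> V -> nat) :
    i < j -> j < k ->
  #|V| ^ 2 * seqsum k (fun s => f (nth x0 s i) (nth x0 s j)) =
  #|V| ^ k * \sum_x \sum_y f x y.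
Proof.
elim: k i j => // k IH [|i] [|j] // ij jk /=.
  rewrite !expnS expn0 muln1 -!mulnA; congr (_ * _).
  rewrite !big_distrr /=; apply: eq_bigr => x _.
  by rewrite (seqsum_nth1 x0 (fun y => f x y)).
by rewrite sum_nat_const (mulnCA (_ ^ 2)) IH // expnS mulnA.
Qed.

Lemma seqsum_nth3 (V : finType) (x0 : V) k i j l (f : V -> V -> V -> nat) :
    i < j -> j < l -> l < k ->
  #|V| ^ 3 * seqsum k (fun s => f (nth x0 s i) (nth x0 s j) (nth x0 s l)) =
  #|V| ^ k * \sum_x \sum_y \sum_z f x y z.
Proof.
elim: k i j l => // k IH [|i] [|j] [|l] // ij jl lk /=.
  rewrite (expnS _ 2) (expnS _ k) -!mulnA; congr (_ * _).
  rewrite !big_distrr /=; apply: eq_bigr => x _.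
  by rewrite mulnA mulnn (seqsum_nth2 x0 (f x)).
by rewrite sum_nat_const (mulnCA (_ ^ 3)) IH // expnS mulnA.
Qed.

Lemma seqsum_graph_rel (V : finType) (E : V -> V -> V -> bool) (x0 : V) k
    (i j l : 'I_k) :
    graph_rel E -> i != j -> i != l -> j != l ->
  #|V| ^ 3 * seqsum k (fun s => E (nth x0 s i) (nth x0 s j) (nth x0 s l)) =
  #|V| ^ k * \sum_x \sum_y \sum_z E x y z.
Proof.
move=> [sw ro _]; rewrite -!val_eqE /=.
pose f x y z : nat := E x y z.
have main (a b c : 'I_k) : a < b -> b < c ->
  #|V| ^ 3 * seqsum k (fun s => E (nth x0 s a) (nth x0 s b) (nth x0 s c)) =
  #|V| ^ k * \sum_x \sum_y \sum_z E x y z.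
  by move=> ab bc; apply: (seqsum_nth3 x0 f ab bc).
move=> /eqP ij /eqP il /eqP jl.
case: (ltngtP i j) => // lij; case: (ltngtP i l) => // lil;
  case: (ltngtP j l) => // ljl; try lia.
- exact: main.
- rewrite -(main i l j) //; congr (_ * _); apply: eq_seqsum => s _.
  by rewrite -ro sw.
- rewrite -(main l i j) //; congr (_ * _); apply: eq_seqsum => s _.
  by rewrite -ro.
- rewrite -(main j i l) //; congr (_ * _); apply: eq_seqsum => s _.
  by rewrite sw.
- rewrite -(main j l i) //; congr (_ * _); apply: eq_seqsum => s _.
  by rewrite ro.
- rewrite -(main l j i) //; congr (_ * _); apply: eq_seqsum => s _.
  by rewrite sw -ro.
Qed.

Lemma leq_ffact_expn n m : n ^_ m <= n ^ m.
Proof.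
elim: m => // m IH; rewrite ffactnSr expnSr leq_mul //; exact: leq_subr.
Qed.

Lemma leq_expn_ffact n m : (n - m) ^ m <= n ^_ m.
Proof.
elim: m => // m IH; rewrite ffactnSr expnSr leq_mul //; last by lia.
by apply: leq_trans IH; case: m => // m; rewrite leq_exp2r //; lia.
Qed.

Lemma bin_density n d s q : 4 * q * s <= n -> n <= 2 * q * d ->
  'C(n, s) <= s`! * (4 * q) ^ s * 'C(d, s).
Proof.
move=> ns nd; apply: leq_trans (_ : n ^ s <= _).
  apply: leq_trans (leq_ffact_expn n s); rewrite -bin_ffact.
  by rewrite leq_pmulr // fact_gt0.
rewrite mulnC mulnA bin_ffact mulnC.
apply: leq_trans (leq_mul (leqnn _) (leq_expn_ffact d s)).
by rewrite -expnMn; case: s ns => // s ns; rewrite leq_exp2r //; nia.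
Qed.

(* Erdos' theorem on complete k-partite k-graphs: average over the [s]-subsets
   of possible first coordinates and recurse on the common links. *)
Lemma box_lemma k s q : 0 < q -> exists N, forall (V : finType) (x0 : V)
    (R : seq V -> bool), N <= #|V| -> #|V| ^ k <= q * seqsum k R ->
  exists U : seq {set V}, [/\ size U = k, forall A, A \in U -> #|A| = s &
    forall t, size t = k ->
      (forall i, i < k -> nth x0 t i \in nth set0 U i) -> R t].
Proof.
elim: k q => [|k IH] q q0.
  exists 0 => V x0 R _ /=; case R0: (R [::]); last by rewrite muln0.
  by exists [::]; split=> // -[].
pose Q := s`! * (4 * q) ^ s.
have Q0 : 0 < Q by rewrite muln_gt0 fact_gt0 expn_gt0; lia.
have [|N HN] := IH (2 * q * Q); first by rewrite muln_gt0 Q0 muln_gt0 q0.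
(* The summands serve the recursive call, [bin_density], and the positivity of ['C(n, s)]. *)
exists (N + 4 * q * s + s).+1 => V x0 R; set n := #|V| => Nn.
pose D t := [set x | R (x :: t)].
pose RS (S : {set V}) t := S \subset D t.
have -> : seqsum k.+1 R = seqsum k (fun t => #|D t|).
  rewrite /= -seqsum_sum; apply: eq_seqsum => t _.
  rewrite -sum1_card [RHS]big_mkcond /=; apply: eq_bigr => x _.
  by rewrite inE; case: (R _).
move=> dense.
have C0 : 0 < 'C(n, s) by rewrite bin_gt0; lia.
(* If [D t] has at most [n / (2 * q)] elements the first summand pays; otherwise [D t] contains a
   [1 / Q] proportion of the [s]-sets. *)
have pt t : 2 * q * 'C(n, s) * #|D t| <=
    n * 'C(n, s) + 2 * q * n * Q * 'C(#|D t|, s).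
  have Dn : #|D t| <= n by apply: max_card.
  case: (leqP (2 * q * #|D t|) n) => [h|/ltnW h].
    by apply: leq_trans (leq_addr _ _); rewrite mulnAC leq_mul2r h orbT.
  have B : 'C(n, s) <= Q * 'C(#|D t|, s) by apply: bin_density h; lia.
  apply: leq_trans (leq_addl _ _); rewrite -(mulnA (2 * q * n)) mulnAC.
  by rewrite leq_mul // leq_mul.
have dbl : seqsum k (fun t => 'C(#|D t|, s)) =
    \sum_(S : {set V} | #|S| == s) seqsum k (RS S).
  rewrite -seqsum_sum; apply: eq_seqsum => t _.
  rewrite -cards_draws -sum1_card big_mkcond [RHS]big_mkcond /=.
  apply: eq_bigr => S _; rewrite inE /RS.
  by case: (S \subset _); case: (#|S| == s).
have : 2 * q * 'C(n, s) * seqsum k (fun t => #|D t|) <= n ^ k * (n * 'C(n, s)) +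
    2 * q * n * Q * \sum_(S : {set V} | #|S| == s) seqsum k (RS S).
  rewrite -dbl -seqsumZ -seqsumZ -seqsum_const -seqsumD.
  by apply: leq_seqsum => t _; apply: pt.
set X := seqsum k _ in dense *; set Y := \sum_(S | _) _ => le1.
(* Sparse fibres account for at most half of the tuples granted by [dense], so the other half is
   charged to pairs of a tuple and an [s]-set in its fibre. *)
have le2 : n ^ k * 'C(n, s) <= 2 * q * Q * Y.
  rewrite -(leq_pmul2l (_ : 0 < n)); last by lia.
  have := leq_mul (leqnn (2 * 'C(n, s))) dense; rewrite expnS; nia.
have [/existsP[S /andP[/eqP Ss ge]]|/existsPn no] := boolP [exists S : {set V},
    (#|S| == s) && (n ^ k <= 2 * q * Q * seqsum k (RS S))].
  have [|U [Uk Us UR]] := HN V x0 (RS S) _ ge; first by lia.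
  exists (S :: U); split=> [|A|[|x t] //= [tk] tU]; first by rewrite /= Uk.
    by rewrite inE => /orP[/eqP ->|/Us].
  have /UR/(_ (fun i ik => tU i.+1 ik))/subsetP := tk.
  by move=> /(_ x (tU 0 isT)); rewrite inE.
have : 2 * q * Q * Y < n ^ k * 'C(n, s).
  rewrite big_distrr /= -card_draws -sum1_card big_distrr /=.
  rewrite [X in _ < X](eq_bigl (fun S : {set V} => #|S| == s)); last first.
    by move=> S; rewrite inE.
  have [S0 S0s] : exists S : {set V}, #|S| == s.
    have : 0 < #|[set A : {set V} | #|A| == s]| by rewrite card_draws.
    by case/card_gt0P => S; rewrite inE; exists S.
  rewrite (bigD1 S0) //= [X in _ < X](bigD1 S0) //= -addSn leq_add //.
    by have := no S0; rewrite S0s /= -ltnNge muln1.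
  apply: leq_sum => S /andP[Ss _]; have := no S.
  by rewrite Ss /= -ltnNge muln1 => /ltnW.
by rewrite ltnNge le2.
Qed.

(** Greedy choice: fewer than [#|T|] values are taken when the next one is picked. *)
Lemma injective_choice (T V : finType) (A : T -> {set V}) :
    (forall t, #|T| <= #|A t|) ->
  exists2 f : T -> V, injective f & forall t, f t \in A t.
Proof.
move=> TA; have step (r : seq T) : uniq r ->
    exists f : T -> V, {in r &, injective f} /\ {in r, forall t, f t \in A t}.
  elim: r => [_|a r IH /= /andP[ar ur]].
    have [t _|noT] := pickP (@predT T); last first.
      have f : T -> V by move=> t; have := noT t.
      by exists f; split=> t; rewrite in_nil.
    have /card_gt0P[v _] : 0 < #|A t|.
      by apply: leq_trans (TA t); apply/card_gt0P; exists t.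
    by exists (fun _ => v); split=> ?; rewrite in_nil.
  have [f [finj fA]] := IH ur.
  have /card_gt0P[v] : 0 < #|A a :\: [set f t | t in r]|.
    rewrite cardsD subn_gt0; apply: leq_trans (TA a).
    apply: leq_ltn_trans (subset_leq_card (subsetIr _ _)) _.
    apply: leq_ltn_trans (leq_imset_card _ _) _.
    have uar : uniq (a :: r) by rewrite /= ar.
    by rewrite (card_uniqP ur); have := max_card (mem (a :: r));
      rewrite (card_uniqP uar).
  rewrite inE => /andP[vf vA].
  have new t : t \in r -> v != f t.
    by move=> tr; apply: contraNneq vf => ->; apply: imset_f.
  exists (fun t => if t == a then v else f t); split=> [s t|t].
    rewrite !inE; case: (eqVneq s a) => [->|_] /=; case: (eqVneq t a) => [->|_] //=.
    - by move=> _ /new /eqP.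
    - by move=> /new /eqP h _ /esym.
    - exact: finj.
  by rewrite inE; case: (eqVneq t a) => [->|_] //= /fA.
have [f [finj fA]] := step _ (enum_uniq T).
by exists f => [s t|t]; [apply: finj | apply: fA]; rewrite mem_enum.
Qed.

Definition pull_rel (V : finType) (E : V -> V -> V -> bool) (x0 : V)
    (s : seq V) (k : nat) (i j l : 'I_k) : bool :=
  E (nth x0 s i) (nth x0 s j) (nth x0 s l).

Lemma pull_graph_rel (V : finType) (E : V -> V -> V -> bool) (x0 : V) s k :
  graph_rel E -> graph_rel (@pull_rel V E x0 s k).
Proof.
by case=> sw ro ir; split=> *; [exact: sw | exact: ro | exact: ir].
Qed.

Definition homb (T V : finType) (F : graph3 T) (E : V -> V -> V -> bool)
    (h : T -> V) : bool :=
  [forall x, [forall y, [forall z,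
    adj (edges F) x y z ==> E (h x) (h y) (h z)]]].

Lemma hom3P (T V : finType) (F : graph3 T) (E : V -> V -> V -> bool)
    (h : T -> V) : reflect (hom3 F E h) (homb F E h).
Proof.
apply: (iffP forallP) => [H x y z|H x].
  by have /forallP/(_ y)/forallP/(_ z)/implyP := H x.
by apply/forallP => y; apply/forallP => z; apply/implyP/H.
Qed.

(** Send each vertex [v] of F into part [h v] of the box, injectively although [h] need not be
    injective. Any edge of F then lies on some transversal of the box, where it is known to be
    mapped to an edge. *)
Lemma box_embedding (T V : finType) (F : graph3 T) (E : V -> V -> V -> bool)
    (x0 : V) k (h : T -> 'I_k) (U : seq {set V}) :
    graph_rel E -> size U = k -> (forall A, A \in U -> #|A| = #|T|) ->
    (forall t, size t = k ->
      (forall i, i < k -> nth x0 t i \in nth set0 U i) ->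
      hom3 F (@pull_rel V E x0 t k) h) ->
  exists2 f : T -> V, injective f & hom3 F E f.
Proof.
move=> [sw ro ir] Uk UT UF.
have Unth i : i < k -> #|nth set0 U i| = #|T|.
  by move=> ik; apply: UT; rewrite mem_nth ?Uk.
have [|f finj fU] := @injective_choice T V (fun v => nth set0 U (h v)).
  by move=> t; rewrite Unth.
exists f => // x y z xyz.
have T0 : 0 < #|T| by apply/card_gt0P; exists x.
pose t0 i := odflt x0 [pick v in nth set0 U i].
have t0U i : i < k -> t0 i \in nth set0 U i.
  move=> ik; rewrite /t0; case: pickP => [v //|no].
  by have := Unth i ik; rewrite (eq_card0 no) => e; rewrite -e in T0.
have hom t : (forall i, i < k -> t i \in nth set0 U i) ->
    E (t (h x)) (t (h y)) (t (h z)).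
  move=> tU; have := UF (mkseq t k) (size_mkseq _ _).
  have tn i : i < k -> nth x0 (mkseq t k) i = t i by move=> ik; rewrite nth_mkseq.
  have mU i : i < k -> nth x0 (mkseq t k) i \in nth set0 U i.
    by move=> ik; rewrite tn // tU.
  by move=> /(_ mU _ _ _ xyz); rewrite /pull_rel !tn.
(* An arbitrary transversal shows that [h] separates the vertices of the edge, so one transversal
   can pass through [f x], [f y] and [f z]. *)
have E0 := hom t0 t0U.
have xy : h x != h y by apply: contraTneq E0 => ->; rewrite ir.
have xz : h x != h z by apply: contraTneq E0 => ->; rewrite -ro ir.
have yz : h y != h z by apply: contraTneq E0 => ->; rewrite ro ir.
have yxF : (h y == h x :> nat) = false.
  by apply: contra_neqF xy => /eqP/val_inj ->.
have zxF : (h z == h x :> nat) = false.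
  by apply: contra_neqF xz => /eqP/val_inj ->.
have zyF : (h z == h y :> nat) = false.
  by apply: contra_neqF yz => /eqP/val_inj ->.
pose t (i : nat) := if i == h x then f x else if i == h y then f y
            else if i == h z then f z else t0 i.
have := hom t; rewrite /t !eqxx yxF zxF zyF; apply=> i ik.
by do 3![case: eqP => [->|_]; first exact: fU]; exact: t0U.
Qed.

Lemma hom_density_to_copy (T : finType) (F : graph3 T) q :
    (forall k (E : 'I_k -> 'I_k -> 'I_k -> bool), graph_rel E ->
       (forall h, ~ hom3 F E h) ->
       9 * \sum_x \sum_y \sum_z E x y z <= 2 * k ^ 3 + 18 * k ^ 2) ->
    0 < q ->
  exists N, forall (V : finType) (E : V -> V -> V -> bool), N <= #|V| ->
    graph_rel E -> (forall f, injective f -> ~ hom3 F E f) ->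
  9 * q * \sum_x \sum_y \sum_z E x y z <= 2 * q.+1 * #|V| ^ 3.
Proof.
(* With this sample size the excess density outweighs both the error [18 * m ^ 2] and the
   [3 * m ^ 2] index triples with a repetition; a surplus of [2 * m ^ 2 * n ^ m] remains in
   [le5]. *)
move=> bound q0; have [m mE] : exists m, m = 12 * q + 4 by exists (12 * q + 4).
pose H := #|{ffun T -> 'I_m}|.
have m0 : 0 < m by rewrite mE addn4.
have H0 : 0 < H.
  by apply/card_gt0P; exists [ffun _ => Ordinal m0].
have c0 : 0 < 9 * q * m ^ 3 * H.
  by rewrite muln_gt0 H0 andbT muln_gt0 expn_gt0 m0 muln_gt0 q0.
have [N HN] := @box_lemma m #|T| _ c0.
exists N.+1 => V E Vn gE noF; set n := #|V| in Vn *.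
rewrite leqNgt; apply/negP => dense; set S := \sum_x _ in dense.
have [x0 _] : exists x0, x0 \in V by apply/card_gt0P; apply: leq_trans Vn.
pose P s i j l : nat := @pull_rel V E x0 s m i j l.
pose hashom s := [exists h : {ffun T -> 'I_m}, homb F (@pull_rel V E x0 s m) h].
(* A sample without homomorphism obeys [bound]; any other has at most [m ^ 3] ordered triples. *)
have pt s : 9 * \sum_i \sum_j \sum_l P s i j l <=
    (2 * m ^ 3 + 18 * m ^ 2) + 9 * m ^ 3 * hashom s.
  case: (boolP (hashom s)) => [_|/existsPn no].
    rewrite muln1; apply: leq_trans (leq_addl _ _).
    rewrite leq_mul2l /= -[m in leqRHS]card_ord !expnS expn0 muln1.
    rewrite -sum_nat_const; apply: leq_sum => i _.
    rewrite -sum_nat_const; apply: leq_sum => j _.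
    rewrite -sum1_card; apply: leq_sum => l _; exact: leq_b1.
  rewrite muln0 addn0; apply: bound; first exact: pull_graph_rel.
  move=> h hh; have /negP[] := no [ffun v => h v]; apply/hom3P => x y z xyz.
  by rewrite !ffunE; apply: hh.
pose B := seqsum m hashom.
have le1 : 9 * \sum_i \sum_j \sum_l seqsum m (fun s => P s i j l) <=
    n ^ m * (2 * m ^ 3 + 18 * m ^ 2) + 9 * m ^ 3 * B.
  rewrite -seqsum_const -seqsumZ -seqsumD.
  have -> : \sum_i \sum_j \sum_l seqsum m (fun s => P s i j l) =
      seqsum m (fun s => \sum_i \sum_j \sum_l P s i j l).
    rewrite seqsum_sum; apply: eq_bigr => i _.
    by rewrite seqsum_sum; apply: eq_bigr => j _; rewrite seqsum_sum.
  by rewrite -seqsumZ; apply: leq_seqsum => s _; apply: pt.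
(* Index triples without repetition have exactly the average density; those with one are compensated
   by the last term. *)
have le2 : m ^ 3 * (n ^ m * S) <=
    n ^ 3 * (\sum_i \sum_j \sum_l seqsum m (fun s => P s i j l)) +
    3 * m ^ 2 * (n ^ m * S).
  set X := n ^ m * S.
  have -> : m ^ 3 * X = \sum_(i < m) \sum_(j < m) \sum_(l < m) X.
    by rewrite !sum_nat_const !card_ord !expnS expn0 muln1 !mulnA.
  have -> : 3 * m ^ 2 * X = \sum_(i < m) \sum_(j < m) \sum_(l < m)
      (X * ((i == j) + (i == l) + (j == l))).
    have d (i : 'I_m) (c : nat) : \sum_(j < m) c * (i == j) = c.
      rewrite (bigD1 i) //= eqxx muln1 big1 ?addn0 // => j.
      by rewrite eq_sym => /negPf ->; rewrite muln0.
    under eq_bigr => i _.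
      under eq_bigr => j _.
        under eq_bigr do rewrite !mulnDr.
        rewrite !big_split /= !d sum_nat_const card_ord.
        over.
      rewrite !big_split /= !sum_nat_const card_ord -big_distrr /= d.
      over.
    rewrite sum_nat_const card_ord; lia.
  rewrite big_distrr -big_split; apply: leq_sum => i _ /=.
  rewrite big_distrr -big_split; apply: leq_sum => j _ /=.
  rewrite big_distrr -big_split; apply: leq_sum => l _ /=.
  case: (eqVneq i j) => [_|ij]; first by rewrite mulnDr mulnDr muln1; lia.
  case: (eqVneq i l) => [_|il]; first by rewrite mulnDr mulnDr muln1; lia.
  case: (eqVneq j l) => [_|jl]; first by rewrite mulnDr mulnDr muln1; lia.
  have XE : n ^ 3 * seqsum m (fun s => P s i j l) = X.
    by rewrite /P /pull_rel (seqsum_graph_rel x0 gE ij il jl).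
  by rewrite XE leq_addr.
have le3 : n ^ m <= 9 * q * m ^ 3 * B.
  set Y := \sum_i _ in le1 le2; have n0 : 0 < n ^ 3 by rewrite expn_gt0; lia.
  have mm : m ^ 3 = 3 * m ^ 2 + (m ^ 2 * (12 * q + 1)).
    by rewrite (expnS m 2) {1}mE; lia.
  set M := n ^ m in le1 le2 *.
  have le4 : m ^ 2 * (12 * q + 1) * (M * S) <= n ^ 3 * Y.
    by rewrite mm mulnDl addnC leq_add2r in le2.
  have le5 : m ^ 2 * (12 * q + 1) * M * (2 * q.+1) * n ^ 3 <=
      q * (M * (2 * m ^ 3 + 18 * m ^ 2) + 9 * m ^ 3 * B) * n ^ 3.
    apply: leq_trans (_ : q * (9 * Y) * n ^ 3 <= _); last first.
      by rewrite leq_mul2r leq_mul2l le1 !orbT.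
    apply: leq_trans (_ : 9 * q * (n ^ 3 * Y) <= _); last by lia.
    apply: leq_trans (leq_mul (leqnn (9 * q)) le4).
    have := leq_mul (leqnn (m ^ 2 * (12 * q + 1) * M)) (ltnW dense); lia.
  rewrite leq_pmul2r // (mulnDr q) in le5.
  have -> : 9 * q * m ^ 3 * B = q * (9 * m ^ 3 * B) by lia.
  set Z := q * (9 * m ^ 3 * B) in le5 *; rewrite mm in le5.
  have MC : M <= m ^ 2 * M by rewrite leq_pmull // expn_gt0 m0.
  by clear -MC le5; move: (m ^ 2) M Z MC le5 => C M' Z' MC le5; lia.
have le4 : B <= \sum_(h : {ffun T -> 'I_m}) seqsum m
    (fun s => homb F (@pull_rel V E x0 s m) h).
  rewrite -seqsum_sum; apply: leq_seqsum => s _.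
  rewrite /hashom; case: existsP => // -[h hh].
  by rewrite (bigD1 h) //= hh.
(* Pigeonhole over the [H] maps: one fixed [h] is a homomorphism for a positive proportion of the
   samples. *)
have [/existsP[h hh]|/existsPn no] := boolP [exists h : {ffun T -> 'I_m},
    n ^ m <= 9 * q * m ^ 3 * H * seqsum m (fun s => homb F (@pull_rel V E x0 s m) h)].
  have [|U [Um UT UR]] := HN V x0 _ _ hh; first exact: ltnW.
  have [f finj fF] := box_embedding gE Um UT (fun t tk tU => hom3P _ _ _ (UR t tk tU)).
  exact: noF finj fF.
have : H * (9 * q * m ^ 3 * B) < H * n ^ m.
  apply: leq_ltn_trans (leq_mul (leqnn H) (leq_mul (leqnn _) le4)) _.
  have -> : H * n ^ m = \sum_(h : {ffun T -> 'I_m}) n ^ m.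
    by rewrite sum_nat_const.
  rewrite mulnA (mulnC H) big_distrr /=.
  have h0 : {ffun T -> 'I_m} by exact: [ffun _ => Ordinal m0].
  rewrite (bigD1 h0) //= [X in _ < X](bigD1 h0) //= -addSn leq_add //.
    by rewrite ltnNge no.
  by apply: leq_sum => h _; apply: ltnW; rewrite ltnNge no.
by rewrite ltnNge leq_mul2l le3 orbT.
Qed.

(** * Blow-ups *)

Lemma graph_rel_set3 (V : finType) (E : V -> V -> V -> bool) x y z a b c :
  graph_rel E -> E a b c -> [set x; y; z] = [set a; b; c] -> E x y z.
Proof.
move=> [sw ro ir] Eabc /eqP.
have ab : a != b by apply: contraTneq Eabc => ->; rewrite ir.
have ac : a != c by apply: contraTneq Eabc => ->; rewrite -ro ir.
have bc : b != c by apply: contraTneq Eabc => ->; rewrite ro ir.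
rewrite set3_eqP // !inE => /or4P[|||/or3P[]] /eqP[-> -> ->] //.
- by rewrite -ro sw.
- by rewrite sw.
- by rewrite -ro.
- by rewrite ro.
- by rewrite sw -ro.
Qed.

Definition rel_edges (V : finType) (E : V -> V -> V -> bool) : {set {set V}} :=
  [set e : {set V} | [exists x, [exists y, [exists z,
     E x y z && (e == [set x; y; z])]]]].

Lemma adj_rel_edges (V : finType) (E : V -> V -> V -> bool) x y z :
  graph_rel E -> adj (rel_edges E) x y z = E x y z.
Proof.
move=> gE; rewrite /adj inE; apply/existsP/idP => [[a /existsP[b /existsP[c]]]|].
  by move=> /andP[Eabc /eqP]; apply: graph_rel_set3.
move=> Exyz; exists x; apply/existsP; exists y; apply/existsP; exists z.
by rewrite Exyz eqxx.
Qed.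

Lemma rel_edges_card3 (V : finType) (E : V -> V -> V -> bool) :
  graph_rel E -> [forall e in rel_edges E, #|e| == 3].
Proof.
move=> [sw ro ir]; apply/forall_inP => e; rewrite inE.
move=> /existsP[x /existsP[y /existsP[z /andP[Exyz /eqP ->]]]].
rewrite set3_card; apply/and3P; split; apply: contraTneq Exyz => ->.
- by rewrite ir.
- by rewrite -ro ir.
- by rewrite ro ir.
Qed.

Lemma contains3_hom3 (T V : finType) (F : graph3 T) (H : graph3 V) :
  contains3 F H <-> exists2 f : T -> V, injective f & hom3 F (adj (edges H)) f.
Proof.
split=> -[f finj fF]; exists f => //.
  by move=> x y z /fF; rewrite /adj !imsetU !imset_set1.
move=> e eF; have /eqP/cards3P[a [b [c [_ _ _ eE]]]] :=
  forall_inP (edges_card3 F) _ eF.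
rewrite eE in eF *; have := fF a b c eF.
by rewrite /adj !imsetU !imset_set1.
Qed.

Definition blowup (n : nat) (f : 'I_n -> bool + bool * bool) x y z : bool :=
  twist (f x) (f y) (f z).

Lemma blowup_graph_rel n (f : 'I_n -> bool + bool * bool) :
  graph_rel (blowup f).
Proof.
by have [sw ro ir] := twist_graph_rel; split=> *; [exact: sw|exact: ro|exact: ir].
Qed.

Definition blowup_graph n (f : 'I_n -> bool + bool * bool) : graph3 'I_n :=
  Graph3 (rel_edges_card3 (blowup_graph_rel f)).

Lemma adj_blowup n (f : 'I_n -> bool + bool * bool) x y z :
  adj (edges (blowup_graph f)) x y z = twist (f x) (f y) (f z).
Proof. exact/adj_rel_edges/blowup_graph_rel. Qed.

Lemma blowup_free n (f : 'I_n -> bool + bool * bool) :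
  ~ contains3 (prod3 K4minus Fstar) (blowup_graph f).
Proof.
move=> /contains3_hom3[h _ hF]; apply: (@no_hom3_twist (f \o h)) => x y z xyz.
by have := hF x y z xyz; rewrite adj_blowup.
Qed.

Lemma fibers_exist (T : finType) (c : T -> nat) n : \sum_t c t = n ->
  exists f : 'I_n -> T, forall t, #|[set i | f i == t]| = c t.
Proof.
move=> cn; pose S : finType := {t : T & 'I_(c t)}.
have Sn : #|{: S}| = n.
  by rewrite card_tagged sumnE big_map big_enum /= -cn; apply: eq_bigr => t _;
     rewrite card_ord.
pose f (i : 'I_n) : T := tag (enum_val (cast_ord (esym Sn) i) : S).
exists f => t; pose g (j : 'I_(c t)) : 'I_n :=
  cast_ord Sn (enum_rank (Tagged (fun t => 'I_(c t)) j : S)).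
have ginj : injective g.
  move=> j j' /cast_ord_inj/enum_rank_inj/eqP; rewrite -tag_eqE /tag_eq /= eqxx.
  by rewrite tagged_asE => /eqP.
have -> : [set i | f i == t] = [set g j | j : 'I_(c t)].
  apply/setP => i; rewrite inE; apply/eqP/imsetP => [ft|[j _ ->]].
    move: ft; rewrite /f; case E: (enum_val _) => [t' j] /= tt'; subst t'.
    exists j => //; apply: val_inj; have := enum_valK (cast_ord (esym Sn) i).
    by rewrite E => /(congr1 val)/esym.
  by rewrite /f /g cast_ordK enum_rankK.
by rewrite card_imset // card_ord.
Qed.

Lemma sum_fibers (T : finType) n (f : 'I_n -> T) (F : T -> nat) :
  \sum_i F (f i) = \sum_t #|[set i | f i == t]| * F t.
Proof.
rewrite (partition_big f predT) //=; apply: eq_bigr => t _.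
rewrite -sum1_card big_distrl /=; under [RHS]eq_bigl do rewrite inE.
by apply: eq_bigr => i /eqP ->; rewrite mul1n.
Qed.

Lemma sum_types (F : bool + bool * bool -> nat) :
  \sum_t F t = F (inl true) + F (inl false) +
    (F (inr (true, true)) + F (inr (true, false)) +
     (F (inr (false, true)) + F (inr (false, false)))).
Proof.
rewrite big_sumType /= big_bool.
have -> : \sum_p F (inr p) = \sum_a \sum_b F (inr (a, b)).
  by rewrite pair_bigA; apply: eq_bigr => -[].
by rewrite !big_bool.
Qed.

(** Complementary B-classes get equal sizes, so that either bit splits the B-vertices into two
    halves of size [u + v]. *)
Definition sizes (a0 a1 u v : nat) (t : bool + bool * bool) : nat :=
  match t with
  | inl i => if i then a1 else a0
  | inr (p, q) => if p == q then u else v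
  end.

(** The link of every A-vertex is complete bipartite between two halves of size [u + v]. *)
Lemma blowup_edges n (f : 'I_n -> bool + bool * bool) a0 a1 u v :
    (forall t, #|[set i | f i == t]| = sizes a0 a1 u v t) ->
  #|edges (blowup_graph f)| = (a0 + a1) * (u + v) ^ 2.
Proof.
move=> ft; have e3 e : e \in edges (blowup_graph f) -> #|e| = 3.
  by move=> /(forall_inP (edges_card3 _))/eqP.
have := sum_adj e3; under eq_bigr => x _ do
  under eq_bigr => y _ do under eq_bigr => z _ do rewrite adj_blowup.
rewrite (sum_fibers f (fun a => \sum_y \sum_z twist a (f y) (f z))).
under eq_bigr => a _ do rewrite (sum_fibers f (fun b => \sum_z twist a b (f z))).
under eq_bigr => a _ do under eq_bigr => b _ do
  rewrite (sum_fibers f (fun c => twist a b c)).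
under eq_bigr => a _ do under eq_bigr => b _ do under eq_bigr => c _ do
  rewrite ft.
under eq_bigr => a _ do under eq_bigr => b _ do rewrite ft sum_types.
under eq_bigr => a _ do rewrite ft sum_types.
rewrite sum_types /= ?(muln0, muln1, addn0, add0n); lia.
Qed.

(** * Squared codegrees, an invariant that separates the blow-ups *)

Definition codeg2 (V : finType) (E : V -> V -> V -> bool) : nat :=
  \sum_x \sum_y (\sum_z E x y z) ^ 2.

(** Put [N = d + e]; the A-classes have sizes [N + d] and [N - d]. Ordered pairs with one A-vertex
    contribute [64 N^4], pairs of B-vertices differing in both bits [16 N^4], and those differing in
    one bit [4 N^2 ((N + d)^2 + (N - d)^2) = 8 N^4 + 8 N^2 d^2]. *)
Lemma blowup_codeg2 n (f : 'I_n -> bool + bool * bool) d e :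
    (forall t, #|[set i | f i == t]| =
       sizes (2 * d + e) e (d + e) (d + e) t) ->
  codeg2 (adj (edges (blowup_graph f))) =
  88 * (d + e) ^ 4 + 8 * (d + e) ^ 2 * d ^ 2.
Proof.
move=> ft; rewrite /codeg2; under eq_bigr => x _ do
  under eq_bigr => y _ do under eq_bigr => z _ do rewrite adj_blowup.
rewrite (sum_fibers f (fun a => \sum_y (\sum_z twist a (f y) (f z)) ^ 2)).
under eq_bigr => a _ do
  rewrite (sum_fibers f (fun b => (\sum_z twist a b (f z)) ^ 2)).
under eq_bigr => a _ do under eq_bigr => b _ do
  rewrite (sum_fibers f (fun c => twist a b c)).
under eq_bigr => a _ do under eq_bigr => b _ do under eq_bigr => c _ do
  rewrite ft.
under eq_bigr => a _ do under eq_bigr => b _ do rewrite ft sum_types.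
under eq_bigr => a _ do rewrite ft sum_types.
rewrite sum_types /= ?(muln0, muln1, addn0, add0n, exp0n) //.
lia.
Qed.

(** A squared codegree counts pairs [z, w] that both complete [x, y] to an edge. Such a pair is
    affected only if one of the two triples was edited, and an edited edge has six orderings. *)
Lemma codeg2_lipschitz (T : finType) (A B : {set {set T}}) :
    (forall e, e \in A -> #|e| = 3) -> (forall e, e \in B -> #|e| = 3) ->
  codeg2 (adj A) <= codeg2 (adj B) + 12 * #|T| * edit_dist A B.
Proof.
move=> A3 B3; set D := (A :\: B) :|: (B :\: A).
have D3 e : e \in D -> #|e| = 3.
  by rewrite !inE => /orP[] /andP[_]; [apply: A3 | apply: B3].
have sq (a : T -> bool) : (\sum_z a z) ^ 2 = \sum_z \sum_w a z * a w.
  by rewrite expnS expn1 big_distrl; apply: eq_bigr => z _; rewrite big_distrr.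
have -> : 12 * #|T| * edit_dist A B = 2 * #|T| * (6 * #|D|).
  by rewrite /edit_dist -/D; lia.
rewrite -(sum_adj D3) [X in _ + X]big_distrr -big_split; apply: leq_sum => x _ /=.
rewrite [X in _ + X]big_distrr -big_split; apply: leq_sum => y _ /=.
rewrite !sq; set S := \sum_z adj D x y z.
have -> : 2 * #|T| * S = \sum_z \sum_w (adj D x y z + adj D x y w).
  under eq_bigr => z _ do rewrite big_split /= sum_nat_const -/S.
  by rewrite big_split /= sum_nat_const -big_distrr -/S /= addnn -mul2n mulnA.
rewrite -big_split; apply: leq_sum => z _ /=.
rewrite -big_split; apply: leq_sum => w _ /=.
have DE u : adj D x y u = (adj A x y u != adj B x y u).
  by rewrite /adj !inE; do 2!case: (_ \in _).
by rewrite !DE; do 4!case: (adj _ _ _ _).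
Qed.

Lemma adj_relabel n (s : {perm 'I_n}) (H : graph3 'I_n) x y z :
  adj (relabel s H) (s x) (s y) (s z) = adj (edges H) x y z.
Proof.
have -> : adj (relabel s H) (s x) (s y) (s z) =
    ([set s t | t in [set x; y; z]] \in relabel s H).
  by rewrite /adj !imsetU !imset_set1.
exact/mem_imset/imset_inj/perm_inj.
Qed.

Lemma codeg2_relabel n (s : {perm 'I_n}) (H : graph3 'I_n) :
  codeg2 (adj (relabel s H)) = codeg2 (adj (edges H)).
Proof.
rewrite /codeg2 (reindex_inj (@perm_inj _ s)); apply: eq_bigr => x _.
rewrite (reindex_inj (@perm_inj _ s)); apply: eq_bigr => y _.
rewrite (reindex_inj (@perm_inj _ s)); congr (_ ^ 2).
by apply: eq_bigr => z _; rewrite adj_relabel.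
Qed.

Lemma relabel_card3 n (s : {perm 'I_n}) (H : graph3 'I_n) e :
  e \in relabel s H -> #|e| = 3.
Proof.
case/imsetP => e' e'H ->; rewrite card_imset; last exact: perm_inj.
exact/eqP/(forall_inP (edges_card3 H)).
Qed.

(** * Turan density and instability *)

From mathcomp Require Import all_order all_algebra.
From mathcomp Require Import all_classical all_reals all_analysis.
From mathcomp Require Import lra.
Import Order.TTheory GRing.Theory Num.Theory.
Import numFieldNormedType.Exports.

Lemma free3_single_F n (H : graph3 'I_n) : free3 (single F_K4minus_Fstar) H <->
  ~ contains3 (prod3 K4minus Fstar) H.
Proof. by split=> [h|h F ->] //; apply: (h F_K4minus_Fstar). Qed.

Lemma ex3_ge n (H : graph3 'I_n) : ~ contains3 (prod3 K4minus Fstar) H ->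
  #|edges H| <= ex3 n (single F_K4minus_Fstar).
Proof.
by move=> /free3_single_F/asboolT h; apply: (@leq_bigmax_cond _ _ (fun H => #|edges H|)).
Qed.

(** Ordered triples count each edge six times, which turns the factor 2/9 into 1/27. *)
Lemma ex3_upper q : 0 < q -> exists N, forall n, N <= n ->
  27 * q * ex3 n (single F_K4minus_Fstar) <= q.+1 * n ^ 3.
Proof.
move=> q0; have [|N HN] := @hom_density_to_copy _ (prod3 K4minus Fstar) q _ q0.
  move=> k E gE /(no_hom3_free gE)[K4 Fs].
  by have := free_rel_bound gE K4 Fs; rewrite card_ord.
exists N => n Nn; rewrite mulnC -leq_divRL; last by rewrite muln_gt0.
apply/bigmax_leqP => H /asboolP/free3_single_F HF.
rewrite leq_divRL; last by rewrite muln_gt0.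
have := HN _ (adj (edges H)) _ (adj_graph_rel H).
rewrite card_ord => /(_ Nn) => h.
have {}h := h (fun f fi fF => HF ((contains3_hom3 _ _).2 (ex_intro2 _ _ f fi fF))).
rewrite sum_adj in h; first lia.
by move=> e /(forall_inP (edges_card3 H))/eqP.
Qed.

Lemma blowup_exists n a0 a1 u v : n = a0 + a1 + 2 * (u + v) ->
  exists f : 'I_n -> bool + bool * bool,
    forall t, #|[set i | f i == t]%SET| = sizes a0 a1 u v t.
Proof. by move=> nE; apply: fibers_exist; rewrite sum_types /=; lia. Qed.

Lemma ex3_lower n : (n %/ 3) ^ 3 <= ex3 n (single F_K4minus_Fstar).
Proof.
set r := n %/ 3; have rn : 3 * r <= n by rewrite mulnC leq_trunc_div.
(* Only A_0, B_00 and B_11 are nonempty here, so the blow-up is complete tripartite. *)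
have [|f ft] := @blowup_exists n (n - 2 * r) 0 r 0; first by lia.
apply: leq_trans (ex3_ge (@blowup_free n f)); rewrite (blowup_edges ft).
by rewrite !addn0 expnS leq_mul2r; apply/orP; right; lia.
Qed.

Lemma bin3_mul6 n : 6 * 'C(n, 3) = n * (n - 1) * (n - 2).
Proof. by have := bin_ffact n 3; rewrite !ffactnSr ffactn0 !mul1n subn0 mulnC. Qed.

Lemma ex3_bin_upper q : 0 < q -> exists N, forall n, N <= n ->
  9 * q * ex3 n (single F_K4minus_Fstar) <= 2 * q.+1 * 'C(n, 3).
Proof.
(* Doubling [q] leaves room to replace [n ^ 3] by [n * (n - 1) * (n - 2)]. *)
move=> q0; have [|N HN] := @ex3_upper (2 * q); first by rewrite muln_gt0.
exists (N + 6 * q + 6) => n Nn; have := HN n; have := bin3_mul6 n.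
move: (ex3 _ _) 'C(n, 3) => e b bE /(_ ltac:(lia)) eE.
suff : 6 * (9 * q * e) <= 6 * (2 * q.+1 * b) by lia.
have -> : 6 * (2 * q.+1 * b) = 2 * q.+1 * (6 * b) by lia.
rewrite bE; have [k kE] : exists k, n = k + 6 * q + 6.
  by exists (n - 6 * q - 6); lia.
have -> : n - 1 = k + 6 * q + 5 by lia.
have -> : n - 2 = k + 6 * q + 4 by lia.
rewrite kE in eE *; clear -eE q0; nia.
Qed.

Lemma ex3_bin_lower q : exists N, forall n, N <= n ->
  2 * q * 'C(n, 3) <= 9 * q.+1 * ex3 n (single F_K4minus_Fstar).
Proof.
exists (5 * q + 5) => n Nn; have := ex3_lower n; have := bin3_mul6 n.
have := ltn_ceil n (isT : 0 < 3).
move: (ex3 _ _) 'C(n, 3) (n %/ 3) => e b r nr bE re.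
suff : 6 * (2 * q * b) <= 6 * (9 * q.+1 * e) by lia.
have -> : 6 * (2 * q * b) = 2 * q * (6 * b) by lia.
rewrite bE; have [k [kE kq]] : exists k, n = k + 2 /\ 5 * q < k.
  by exists (n - 2); lia.
have -> : n - 1 = k + 1 by lia.
have -> : n - 2 = k by lia.
have kr : k <= 3 * r by lia.
apply: (@leq_trans (2 * q.+1 * k ^ 3)).
  rewrite kE; clear -kq; nia.
have : k ^ 3 <= (3 * r) ^ 3 by rewrite leq_exp2r.
clear -re; nia.
Qed.

(** The two values of [codeg2] differ by at least [8 * r ^ 4]. If both blow-ups were this close to
    [H], each edit distance would account for at most [3 * r ^ 4], which is the origin of the
    constant [4 * (6 * T) ^ 4]. *)
Lemma blowups_far n r T j k (H : graph3 'I_n) (s s' : {perm 'I_n})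
    (f f' : 'I_n -> bool + bool * bool) :
    0 < r -> j < k -> k < T -> n = 6 * T * r ->
    (forall t, #|[set i | f i == t]%SET| =
       sizes (2 * (j * r) + (T - j) * r) ((T - j) * r)
         (j * r + (T - j) * r) (j * r + (T - j) * r) t) ->
    (forall t, #|[set i | f' i == t]%SET| =
       sizes (2 * (k * r) + (T - k) * r) ((T - k) * r)
         (k * r + (T - k) * r) (k * r + (T - k) * r) t) ->
    edit_dist (relabel s (blowup_graph f)) (edges H) * (4 * (6 * T) ^ 4) <=
      n ^ 3 ->
    edit_dist (relabel s' (blowup_graph f')) (edges H) * (4 * (6 * T) ^ 4) <=
      n ^ 3 ->
  False.
Proof.
move=> r0 jk kT nE ft ft'.
set d := edit_dist _ _; set d' := edit_dist _ _.
have dist_sym : edit_dist (edges H) (relabel s (blowup_graph f)) = d.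
  by rewrite /d /edit_dist finset.setUC.
have H3 e : e \in edges H -> #|e| = 3.
  by move=> /(forall_inP (edges_card3 H))/eqP.
have l1 := codeg2_lipschitz H3 (@relabel_card3 _ s (blowup_graph f)).
have l2 := codeg2_lipschitz (@relabel_card3 _ s' (blowup_graph f')) H3.
rewrite dist_sym card_ord codeg2_relabel (blowup_codeg2 ft) in l1.
rewrite -/d' card_ord codeg2_relabel (blowup_codeg2 ft') in l2.
have jT : j * r + (T - j) * r = T * r.
  by rewrite -mulnDl subnKC // ltnW // (ltn_trans jk).
have kT' : k * r + (T - k) * r = T * r by rewrite -mulnDl subnKC // ltnW.
rewrite jT in l1; rewrite kT' in l2.
have l3 := leq_trans l2 (leq_add l1 (leqnn _)); clear l1 l2 ft ft' dist_sym H3.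
have {}l3 : 8 * (T * r) ^ 2 * (k * r) ^ 2 <=
    8 * (T * r) ^ 2 * (j * r) ^ 2 + 12 * n * (d + d').
  move: l3; clear; move: d d' (88 * (T * r) ^ 4) (8 * (T * r) ^ 2 * (k * r) ^ 2).
  by move: (8 * (T * r) ^ 2 * (j * r) ^ 2) => *; lia.
move: d d' l3 => d d' l3.
have M0 : 0 < 6 * T by rewrite muln_gt0 (leq_ltn_trans _ kT).
have key x : x * (4 * (6 * T) ^ 4) <= n ^ 3 -> 4 * (6 * T) * x <= r ^ 3.
  rewrite nE (expnMn (6 * T) r) (expnS (6 * T) 3) => h.
  rewrite -(leq_pmul2l (_ : 0 < (6 * T) ^ 3)) ?expn_gt0 ?M0 //.
  by apply: leq_trans h; clear; move: ((6 * T) ^ 3) => b; lia.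
move=> /key h /key h'.
have l4 : 12 * n * (d + d') <= 6 * r ^ 4.
  have := leq_mul (leqnn (3 * r)) (leq_add h h'); rewrite nE (expnS r 3).
  by clear; move: (r ^ 3) (6 * T) => a b; lia.
have l5 := leq_trans l3 (leq_add (leqnn _) l4).
have jk2 : (j * r) ^ 2 + r ^ 2 <= (k * r) ^ 2.
  rewrite !expnMn -mulSnr leq_mul2r; apply/orP; right.
  by clear -jk; nia.
have Tr : r ^ 2 <= (T * r) ^ 2 by rewrite leq_sqr leq_pmull // (leq_ltn_trans _ kT).
have l6 := leq_mul (leqnn (8 * (T * r) ^ 2)) jk2; rewrite mulnDr in l6.
have {l5 l6} := leq_trans l6 l5; rewrite leq_add2l.
have l7 := leq_mul (leq_mul (leqnn 8) Tr) (leqnn (r ^ 2)).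
move=> /(leq_trans l7); rewrite -mulnA -expnD leq_mul2r.
by rewrite -leqn0 leqNgt expn_gt0 r0.
Qed.

(** Among [t + 1] nearly extremal blow-ups with different splits of A, two are close to the same
    [G i], against [blowups_far]. *)
Lemma not_stable (R : realType) t : ~ stable R (single F_K4minus_Fstar) t.
Proof.
case=> G; set T := t.+1; pose M := 4 * (6 * T) ^ 4.
have M0 : (0 < M)%N by rewrite muln_gt0 expn_gt0.
move=> /(_ (M%:R^-1)%R); rewrite invr_gt0 ltr0n M0 => /(_ isT).
move=> [eps [eps0 [N0 HG]]].
(* Then [(1 - eps) * (1 + 1 / q) < 1], so [n ^ 3 / 27] edges are enough to be nearly extremal. *)
have [q qeps] : exists q : nat, (eps^-1 < q%:R)%R.
  by exists (Num.bound eps^-1); apply: archi_boundP; rewrite invr_ge0 ltW.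
have q0 : (0 < q)%N.
  by rewrite -(ltr0n R); apply: lt_trans qeps; rewrite invr_gt0.
have [N HN] := ex3_upper q0.
pose r := (N0 + N).+1; pose n := 6 * T * r.
have nr : r <= n by rewrite /n leq_pmull.
have Tr (j : 'I_T) : j * r + (T - j) * r = T * r.
  by rewrite -mulnDl subnKC // ltnW.
have blow (j : 'I_T) : exists f : 'I_n -> bool + bool * bool,
    forall u, #|[set i | f i == u]%SET| =
      sizes (2 * (j * r) + (T - j) * r) ((T - j) * r)
         (j * r + (T - j) * r) (j * r + (T - j) * r) u.
  by apply: blowup_exists; rewrite /n; have := Tr j; lia.
have /choice[f fP] : forall j : 'I_T, exists f, _ := blow.
have edgesE j : 27 * #|edges (blowup_graph (f j))| = n ^ 3.
  rewrite (blowup_edges (fP j)) /n -mulnA -(Tr j); clear.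
  by move: (j * r) ((T - j) * r) => a b; lia.
have close (j : 'I_T) : exists i : 'I_t, exists s : {perm 'I_n},
    edit_dist (relabel s (blowup_graph (f j))) (edges (G i n)) * M <= n ^ 3.
  have [|||i [s Hs]] := HG n (blowup_graph (f j)).
  - by apply: leq_trans nr; rewrite /r; lia.
  - exact/free3_single_F/blowup_free.
  - have := HN n; move: (ex3 _ _) (edgesE j) => e eE.
    move=> /(_ ltac:(lia)) le_e.
    set X := #|edges _| in eE *.
    have {}le_e : q * e <= q.+1 * X by lia.
    have X0 : (0 < X)%N.
      have : 0 < n ^ 3 by rewrite expn_gt0 (leq_trans _ nr).
      by rewrite -eE muln_gt0.
    have qe : (1 <= q%:R * eps)%R.
      by rewrite -ler_pdivrMr // div1r ltW.
    move: le_e X0 q0; rewrite -(ler_nat R) -!(ltr_nat R) !natrM -natr1.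
    have e_ge0 : (0 <= e%:R :> R)%R by [].
    move: qe e_ge0; set x : R := X%:R%R; set y : R := e%:R%R; set Q : R := q%:R%R.
    move=> qe y0 yx x0 Q0.
    have Q2 : (0 < Q * Q)%R by rewrite mulr_gt0.
    rewrite -(ltr_pM2l Q2).
    have h1 : (Q * Q * ((1 - eps) * y) <= (Q - 1) * (Q * y))%R.
      have := ler_wpM2r (mulr_ge0 (ltW Q0) y0) qe; lra.
    apply: (le_lt_trans h1).
    have Q1 : (1 <= Q)%R by rewrite /Q ler1n -(ltr0n R).
    have := ler_wpM2l (_ : 0 <= Q - 1)%R yx; rewrite subr_ge0 => /(_ Q1).
    lra.
  exists i, s; rewrite -(ler_nat R) natrM natrX mulrC.
  by rewrite -ler_pdivlMl // ?ltr0n.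
have /choice[c cP] : forall j : 'I_T, exists i, _ := close.
have /injectivePn[j [k jk cjk]] : ~~ injectiveb c.
  apply/negP => /injectiveP/leq_card; rewrite !card_ord.
  by rewrite ltnn.
have far (a b : 'I_T) : a < b -> c a = c b -> False.
  move=> ab cab; have [s Hs] := cP a; have [s' Hs'] := cP b.
  rewrite cab in Hs.
  exact: (blowups_far (r := r) isT ab (ltn_ord b) erefl (fP a) (fP b) Hs Hs').
case: (ltngtP j k) => [lt|lt|/val_inj e]; last by rewrite e eqxx in jk.
  exact: far lt cjk.
exact: far lt (esym cjk).
Qed.

(** For large [n] the ratio lies between 2/9 times [q / (q + 1)] and 2/9 times [(q + 1) / q], and
    [q > 1 / eps] bounds the error. *)
Lemma turan_ratio_cvg (R : realType) :
  (turan_ratio R (single F_K4minus_Fstar) @ \oo --> (2%:R / 9%:R : R))%classic%R.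
Proof.
apply/cvgrPdist_le => /= eps eps0.
have [q qeps] : exists q : nat, (eps^-1 < q%:R)%R.
  by exists (Num.bound eps^-1); apply: archi_boundP; rewrite invr_ge0 ltW.
have q0 : (0 < q)%N.
  by rewrite -(ltr0n R); apply: lt_trans qeps; rewrite invr_gt0.
have [N HN] := ex3_bin_upper q0; have [N' HN'] := ex3_bin_lower q.
exists (N + N' + 3) => // n /= Nn; rewrite /turan_ratio.
have := HN n; have := HN' n; have : (0 < 'C(n, 3))%N by rewrite bin_gt0; lia.
move: (ex3 _ _) 'C(n, 3) => e b b0 /(_ ltac:(lia)) h1 /(_ ltac:(lia)) h2.
have qe : (1 <= q%:R * eps)%R by rewrite -ler_pdivrMr // div1r ltW.
move: b0 q0; rewrite -!(ltr_nat R).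
have q1E : (q.+1%:R = q%:R + 1 :> R)%R by rewrite natr1.
move: h1 h2; rewrite -!(ler_nat R) !natrM !q1E.
move: qe; set Q : R := q%:R%R; set x : R := e%:R%R; set y : R := b%:R%R.
move=> qe h1 h2 y0 Q0.
have x0 : (0 <= x)%R by rewrite /x.
rewrite distrC ler_norml; apply/andP; split.
  rewrite lerBrDl ler_pdivlMr // -(ler_pM2l (_ : 0 < 9 * (Q + 1)))%R; last first.
    by rewrite mulr_gt0 // addr_gt0.
  have := ler_wpM2r (ltW y0) qe; have := mulr_gt0 eps0 y0; lra.
rewrite lerBlDl ler_pdivrMr // -(ler_pM2l (_ : 0 < 9 * Q))%R; last first.
  by rewrite mulr_gt0.
have := ler_wpM2r (ltW y0) qe; lra.
Qed.

Local Open Scope classical_set_scope.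
Local Open Scope ring_scope.

Theorem theorem1p2 (R : realType) :
  [/\ cvgn (turan_ratio R (single F_K4minus_Fstar)),
      turan_density R (single F_K4minus_Fstar) = 2%:R / 9%:R &
      stability_number R (single F_K4minus_Fstar) = +oo%E].
Proof.
have cv := turan_ratio_cvg (R := R); split.
- exact: cvgP cv.
- exact: cvg_lim cv.
rewrite /stability_number (_ : [set t : nat | _] = set0) ?image_set0 ?ereal_inf0 //.
by apply/seteqP; split=> t //= -[_ /not_stable].
Qed.
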